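(* The Jacobson radical $J(r(H_{n,d}))$ of the Green ring $r(H_{n,d})$ is a principal ideal, generated by the element $([M(1,m)]-1)[M(d,0)]$.
   Context: Let $K$ be an algebraically closed field of characteristic $0$, let $n,d\geq 2$ be integers with $d\mid n$, put $m=n/d$, and let $q\in K$ be a primitive $d$-th root of unity. The generalized Taft algebra $H_{n,d}=H_{n,d}(q)$ is the $K$-algebra generated by $g,h$ subject to $g^n=1$, $h^d=0$, $hg=qgh$; it is a Hopf algebra of dimension $nd$ with $\Delta(g)=g\otimes g$, $\Delta(h)=1\otimes h+h\otimes g$, $\varepsilon(g)=1$, $\varepsilon(h)=0$, $S(g)=g^{-1}$, $S(h)=-q^{-1}g^{n-1}h$. Modules are finite dimensional left modules; tensor products of modules are over $K$ with action through $\Delta$. Fix a primitive $n$-th root of unity $\omega\in K$ with $\omega^m=q$. For $1\leq l\leq d$ and $i\in\mathbb{Z}_n=\mathbb{Z}/(n)$, $M(l,i)$ is the $H_{n,d}$-module with basis $v_0,\dots,v_{l-1}$ and action $g\cdot v_j=\omega^i q^{-j}v_j$, $h\cdot v_j=v_{j+1}$ for $0\le j\leq l-2$, $h\cdot v_{l-1}=0$. The modules $M(l,i)$ form a complete list of pairwise non-isomorphic indecomposable $H_{n,d}$-modules. The Green ring $r(H)$ of a Hopf algebra $H$ is the abelian group generated by isomorphism classes $[V]$ of finite dimensional $H$-modules modulo $[V\oplus W]=[V]+[W]$, with multiplication $[V][W]=[V\otimes W]$; its identity $1$ is the class of the trivial $1$-dimensional module. *)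

(* Defs.v *)
From HB Require Import structures.
From mathcomp Require Import all_boot all_order all_algebra.
From mathcomp Require Import boolp classical_sets.
From mathcomp Require Import mxtens freeg.
From mathcomp Require Import ring.

Set Implicit Arguments.
Unset Strict Implicit.
Unset Printing Implicit Defensive.

Import GRing.Theory.
Local Open Scope ring_scope.

(* Ideal-theoretic notions, for rings that are not assumed commutative: left
   ideals for the Jacobson radical, two-sided ideals for principal ideals. *)
Section RingIdeals.
Variable R : pzRingType.
Implicit Types (I : set R) (a x y : R).

Definition left_ideal I : Prop :=
  [/\ I 0, forall x y, I x -> I y -> I (x + y) & forall a x, I x -> I (a * x)].

Definition two_sided_ideal I : Prop :=
  left_ideal I /\ forall a x, I x -> I (x * a).

Definition maximal_left_ideal I : Prop :=
  [/\ left_ideal I, I <> setT &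
      forall L, left_ideal L -> (I `<=` L)%classic -> L = I \/ L = setT].

Definition jacobson_radical : set R :=
  (\bigcap_(I in maximal_left_ideal) I)%classic.

Definition principal_ideal x : set R := smallest two_sided_ideal [set x]%classic.

End RingIdeals.

Arguments jacobson_radical R : clear implicits.

(* A left module over the algebra H_{n,d}(q) generated by g and h with
   relations g^n = 1, h^d = 0 and hg = qgh, on the space of column vectors
   K^k, is given by the matrices of g and h. *)
Record taft_mod (K : fieldType) (n d : nat) (q : K) := TaftMod {
  tdim : nat;
  tg : 'M[K]_tdim;
  th : 'M[K]_tdim;
  tg_exp : tg ^+ n = 1;
  th_exp : th ^+ d = 0;
  th_tg : th *m tg = q *: (tg *m th)
}.

HB.instance Definition _ K n d q := gen_eqMixin (@taft_mod K n d q).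
HB.instance Definition _ K n d q := gen_choiceMixin (@taft_mod K n d q).

Section QBinomial.
Variables (K : fieldType) (q : K).

Definition qint k : K := \sum_(i < k) q ^+ i.

Fixpoint qbin N k : K :=
  match N, k with
  | _, 0%N => 1
  | 0%N, _.+1 => 0
  | N'.+1, k'.+1 => qbin N' k' + q ^+ k'.+1 * qbin N' k'.+1
  end.

Lemma qint0 : qint 0 = 0. Proof. exact: big_ord0. Qed.

Lemma qintS k : qint k.+1 = 1 + q * qint k.
Proof.
rewrite /qint big_ord_recl expr0 mulr_sumr; congr (_ + _).
by apply: eq_bigr => i _; rewrite /= exprS.
Qed.

Lemma qintSr k : qint k.+1 = qint k + q ^+ k.
Proof. by rewrite /qint big_ord_recr. Qed.

Lemma qbin0 N : qbin N 0 = 1. Proof. by case: N. Qed.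

Lemma qbinS N k : qbin N.+1 k.+1 = qbin N k + q ^+ k.+1 * qbin N k.+1.
Proof. by []. Qed.

Lemma qbin_small N k : (N < k)%N -> qbin N k = 0.
Proof.
elim: N k => [|N IH] [|k] //= ltNk.
by rewrite !IH ?mulr0 ?addr0 // ltnW.
Qed.

Lemma qbinn N : qbin N N = 1.
Proof. by elim: N => //= N ->; rewrite qbin_small // mulr0 addr0. Qed.

Lemma qint_qbin N k : qint k.+1 * qbin N.+1 k.+1 = qint N.+1 * qbin N k.
Proof.
elim: N k => [|N IH] k.
  case: k => [|k]; first by rewrite /= mulr0 addr0.
  by rewrite /= !mulr0 addr0 mulr0.
case: k => [|k].
  rewrite qbinS !qbin0 mulrDr mulrCA IH qbin0 !mulr1 (qintS N.+1) expr1.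
  by rewrite /qint big_ord1 expr0.
rewrite qbinS mulrDr (mulrCA (qint k.+2)) IH (qintS k.+1) mulrDl mul1r -mulrA IH.
by rewrite (qintS N.+1) (qbinS N k) !exprS; ring.
Qed.

Lemma qbin_eq0 d k : d.-primitive_root q -> (0 < k < d)%N -> qbin d k = 0.
Proof.
case: d k => [|d] [|k] // prim_q /andP[_ ltkd].
have q1 j : (0 < j < d.+1)%N -> 1 - q ^+ j != 0.
  case/andP=> j_gt0 ltjd; rewrite subr_eq0 eq_sym -(prim_order_dvd prim_q).
  by apply/negP => /(dvdn_leq j_gt0); rewrite leqNgt ltjd.
have d0 : (0 < 1 < d.+1)%N by case: d ltkd {prim_q q1} => // d; case: k.
have geo j : (1 - q) * qint j = 1 - q ^+ j.
  elim: j => [|j IH]; first by rewrite qint0 mulr0 expr0 subrr.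
  by rewrite qintSr mulrDr IH !exprS; ring.
have nz1 : 1 - q != 0 by have := q1 _ d0; rewrite expr1.
have qd0 : qint d.+1 = 0.
  apply: (mulfI nz1); rewrite mulr0 geo.
  by rewrite (prim_expr_order prim_q) subrr.
have qk0 : qint k.+1 != 0.
  apply/eqP => e0; have /eqP := geo k.+1; rewrite e0 mulr0 eq_sym.
  by apply/negP; apply: q1.
by apply: (mulfI qk0); rewrite qint_qbin qd0 mul0r mulr0.
Qed.

Local Arguments qbin : simpl never.

Lemma qcomm_exp l (A B : 'M[K]_l) k :
  B *m A = q *: (A *m B) -> B *m A ^+ k = q ^+ k *: (A ^+ k *m B).
Proof.
move=> BA; elim: k => [|k IH]; first by rewrite !expr0 mulmx1 mul1mx scale1r.
rewrite exprS -mulmxE mulmxA BA -scalemxAl -!mulmxA IH -scalemxAr scalerA.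
by rewrite -exprS.
Qed.

Lemma qbinomial l (A B : 'M[K]_l) N : B *m A = q *: (A *m B) ->
  (A + B) ^+ N = \sum_(k < N.+1) qbin N k *: (A ^+ k *m B ^+ (N - k)).
Proof.
move=> BA; elim: N => [|N IH].
  by rewrite big_ord1 !expr0 scale1r mulmx1.
have mulB : B *m (\sum_(k < N.+1) qbin N k *: (A ^+ k *m B ^+ (N - k))) =
    \sum_(k < N.+2) (q ^+ k * qbin N k) *: (A ^+ k *m B ^+ (N.+1 - k)).
  rewrite mulmx_sumr [RHS]big_ord_recr /= (qbin_small (leqnn _)) mulr0 scale0r.
  rewrite addr0; apply: eq_bigr => i _.
  rewrite -scalemxAr mulmxA (qcomm_exp i BA) -scalemxAl scalerA mulrC -mulmxA.
  by rewrite -[B *m _]/(B * _) -exprS subSn // -ltnS.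
rewrite exprS IH -mulmxE mulmxDl mulB mulmx_sumr.
rewrite [X in _ + X]big_ord_recl [RHS]big_ord_recl /= !qbin0.
rewrite expr0 mul1r addrCA; congr (_ + _).
rewrite -big_split /=; apply: eq_bigr => i _.
rewrite /bump /= add1n subSS scalerDl; congr (_ + _).
by rewrite -scalemxAr mulmxA mulmxE -exprS.
Qed.

Lemma qbinomial_prim l (A B : 'M[K]_l) d : d.-primitive_root q ->
  B *m A = q *: (A *m B) -> (A + B) ^+ d = A ^+ d + B ^+ d.
Proof.
move=> prim_q BA; have := prim_order_gt0 prim_q; case: d prim_q => // d prim_q _.
rewrite (qbinomial _ BA) big_ord_recl big_ord_recr big1 => [|i _].
  rewrite !lift0 /= qbin0 qbinn subnn subn0 !expr0 mul1mx mulmx1.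
  by rewrite !scale1r add0r addrC.
by rewrite lift0 qbin_eq0 ?scale0r //= ltnS.
Qed.

End QBinomial.

Section TaftModules.
Variables (K : fieldType) (n d : nat) (q : K).
Local Notation taft_mod := (taft_mod n d q).
Implicit Types U V W : taft_mod.

Definition taft_iso V W : Prop :=
  exists (P : 'M[K]_(tdim W, tdim V)) (Q : 'M[K]_(tdim V, tdim W)),
    [/\ Q *m P = 1%:M, P *m Q = 1%:M,
        P *m tg V = tg W *m P & P *m th V = th W *m P].

Lemma taft_iso_refl V : taft_iso V V.
Proof. by exists 1%:M, 1%:M; rewrite !mulmx1 !mul1mx. Qed.

Lemma taft_iso_bij V W (f : 'I_(tdim W) -> 'I_(tdim V)) g :
  cancel f g -> cancel g f ->
  (forall i j, tg W i j = tg V (f i) (f j)) ->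
  (forall i j, th W i j = th V (f i) (f j)) -> taft_iso V W.
Proof.
move=> fK gK eg eh.
pose P : 'M[K]_(tdim W, tdim V) := \matrix_(i, j) (f i == j)%:R.
pose Q : 'M[K]_(tdim V, tdim W) := \matrix_(i, j) (g i == j)%:R.
have mulP p (A : 'M[K]_(_, p)) i j : (P *m A) i j = A (f i) j.
  rewrite mxE (bigD1 (f i)) //= big1 => [|k ne_k].
    by rewrite mxE eqxx mul1r addr0.
  by rewrite mxE eq_sym (negPf ne_k) mul0r.
have mulrP p (A : 'M[K]_(p, _)) i j : (A *m P) i j = A i (g j).
  rewrite mxE (bigD1 (g j)) //= big1 => [|k ne_k].
    by rewrite mxE gK eqxx mulr1 addr0.
  by rewrite mxE (can2_eq fK gK) (negPf ne_k) mulr0.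
exists P, Q; split; apply/matrixP => i j.
- by rewrite mulrP !mxE (can_eq gK).
- by rewrite mulP !mxE fK.
- by rewrite mulP mulrP eg gK.
- by rewrite mulP mulrP eh gK.
Qed.

Lemma block_diag_exp k l (A : 'M[K]_k) (B : 'M[K]_l) m :
  block_mx A 0 0 B ^+ m = block_mx (A ^+ m) 0 0 (B ^+ m).
Proof.
elim: m => [|m IH]; first by rewrite !expr0 -scalar_mx_block.
rewrite !exprS IH -!mulmxE mulmx_block.
by rewrite !(mulmx0, mul0mx) !(addr0, add0r).
Qed.

Program Definition taft_dsum V W : taft_mod :=
  @TaftMod K n d q (tdim V + tdim W)
    (block_mx (tg V) 0 0 (tg W)) (block_mx (th V) 0 0 (th W)) _ _ _.
Next Obligation. by rewrite block_diag_exp !tg_exp -scalar_mx_block. Qed.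
Next Obligation. by rewrite block_diag_exp !th_exp block_mx_const. Qed.
Next Obligation.
rewrite !mulmx_block !(mulmx0, mul0mx) !(addr0, add0r) !th_tg.
by rewrite scale_block_mx !scaler0.
Qed.

Hypothesis prim_q : d.-primitive_root q.

Program Definition taft_one : taft_mod := @TaftMod K n d q 1 1 0 _ _ _.
Next Obligation. exact: expr1n. Qed.
Next Obligation. by rewrite expr0n eqn0Ngt (prim_order_gt0 prim_q). Qed.
Next Obligation. by rewrite mul0mx mulmx0 scaler0. Qed.

Lemma tensmx_exp k l (A : 'M[K]_k) (B : 'M[K]_l) m :
  (A *t B) ^+ m = A ^+ m *t B ^+ m.
Proof.
elim: m => [|m IH].
  apply/matrixP => i j; case: (mxtens_indexP i) => a b.
  case: (mxtens_indexP j) => a' b'.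
  rewrite tensmxE !expr0 !mxE -natrM mulnb.
  by rewrite (can_eq (@mxtens_indexK _ _)) xpair_eqE.
by rewrite !exprS IH -!mulmxE tensmx_mul.
Qed.

Lemma tensmxZl k l k' l' (A : 'M[K]_(k, l)) (B : 'M[K]_(k', l')) c :
  (c *: A) *t B = c *: (A *t B).
Proof. by apply/matrixP => i j; rewrite !mxE mulrA. Qed.

Lemma tensmxZr k l k' l' (A : 'M[K]_(k, l)) (B : 'M[K]_(k', l')) c :
  A *t (c *: B) = c *: (A *t B).
Proof. by apply/matrixP => i j; rewrite !mxE mulrCA. Qed.

Lemma tensmx11 k l : (1%:M : 'M[K]_k) *t (1%:M : 'M[K]_l) = 1%:M.
Proof. by have := tensmx_exp (1%:M : 'M[K]_k) (1%:M : 'M[K]_l) 0; rewrite !expr0. Qed.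

(* The action on V (x) W through Delta(g) = g (x) g and
   Delta(h) = 1 (x) h + h (x) g. *)
Program Definition taft_tens V W : taft_mod :=
  @TaftMod K n d q (tdim V * tdim W)
    (tg V *t tg W) (1%:M *t th W + th V *t tg W) _ _ _.
Next Obligation. by rewrite tensmx_exp !tg_exp tensmx11. Qed.
Next Obligation.
rewrite addrC (@qbinomial_prim _ q) //.
  by rewrite !tensmx_exp !th_exp tens0mx tensmx0 addr0.
by rewrite !tensmx_mul mul1mx mulmx1 th_tg tensmxZr.
Qed.
Next Obligation.
rewrite mulmxDl mulmxDr !tensmx_mul mul1mx mulmx1 !th_tg tensmxZr tensmxZl.
by rewrite scalerDr.
Qed.

Lemma addmxE k l (A B : 'M[K]_(k, l)) i j : (A + B) i j = A i j + B i j.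
Proof. exact: mxE. Qed.

Lemma taft_iso_tensl U V W :
  taft_iso V W -> taft_iso (taft_tens V U) (taft_tens W U).
Proof.
case=> P [Q [QP PQ Pg Ph]]; exists (P *t 1%:M), (Q *t 1%:M); split => /=.
- by rewrite tensmx_mul QP mulmx1 tensmx11.
- by rewrite tensmx_mul PQ mulmx1 tensmx11.
- by rewrite !tensmx_mul Pg mul1mx mulmx1.
- by rewrite mulmxDr mulmxDl !tensmx_mul Ph !mul1mx !mulmx1.
Qed.

Lemma taft_iso_tensr U V W :
  taft_iso V W -> taft_iso (taft_tens U V) (taft_tens U W).
Proof.
case=> P [Q [QP PQ Pg Ph]]; exists (1%:M *t P), (1%:M *t Q); split => /=.
- by rewrite tensmx_mul QP mulmx1 tensmx11.
- by rewrite tensmx_mul PQ mulmx1 tensmx11.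
- by rewrite !tensmx_mul Pg mul1mx mulmx1.
- by rewrite mulmxDr mulmxDl !tensmx_mul Pg Ph !mul1mx !mulmx1.
Qed.

Lemma taft_tensA U V W :
  taft_iso (taft_tens (taft_tens U V) W) (taft_tens U (taft_tens V W)).
Proof.
pose f (i : 'I_(tdim U * (tdim V * tdim W))) : 'I_(tdim U * tdim V * tdim W) :=
  let j := mxtens_unindex i in let k := mxtens_unindex j.2 in
  mxtens_index (mxtens_index (j.1, k.1), k.2).
pose g (i : 'I_(tdim U * tdim V * tdim W)) : 'I_(tdim U * (tdim V * tdim W)) :=
  let j := mxtens_unindex i in let k := mxtens_unindex j.1 in
  mxtens_index (k.1, mxtens_index (k.2, j.2)).
have fE a b c : f (mxtens_index (a, mxtens_index (b, c))) =
    mxtens_index (mxtens_index (a, b), c) by rewrite /f !mxtens_indexK.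
apply: (@taft_iso_bij (taft_tens (taft_tens U V) W)
          (taft_tens U (taft_tens V W)) f g) => /=.
- move=> i; case: (mxtens_indexP i) => a j; case: (mxtens_indexP j) => b c.
  by rewrite fE /g !mxtens_indexK.
- move=> i; case: (mxtens_indexP i) => j c; case: (mxtens_indexP j) => a b.
  by rewrite /g !mxtens_indexK fE.
- move=> i i'; case: (mxtens_indexP i) => a j; case: (mxtens_indexP j) => b c.
  case: (mxtens_indexP i') => a' j'; case: (mxtens_indexP j') => b' c'.
  by rewrite !fE !tensmxE mulrA.
- move=> i i'; case: (mxtens_indexP i) => a j; case: (mxtens_indexP j) => b c.
  case: (mxtens_indexP i') => a' j'; case: (mxtens_indexP j') => b' c'.
  rewrite !fE -(@tensmx11 (tdim U) (tdim V)).
  by rewrite !addmxE !tensmxE !addmxE !tensmxE; ring.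
Qed.

Lemma taft_tens1l V : taft_iso (taft_tens taft_one V) V.
Proof.
pose f (i : 'I_(tdim V)) : 'I_(1 * tdim V) := mxtens_index (ord0, i).
pose g (i : 'I_(1 * tdim V)) : 'I_(tdim V) := (mxtens_unindex i).2.
apply: (@taft_iso_bij (taft_tens taft_one V)
          V f g) => /=.
- by move=> i; rewrite /f /g mxtens_indexK.
- by move=> i; case: (mxtens_indexP i) => a b; rewrite [a]ord1 /g mxtens_indexK.
- by move=> i j; rewrite tensmxE mxE mul1r.
- by move=> i j; rewrite !addmxE !tensmxE !mxE mul0r mul1r addr0.
Qed.

Lemma taft_tens1r V : taft_iso (taft_tens V taft_one) V.
Proof.
pose f (i : 'I_(tdim V)) : 'I_(tdim V * 1) := mxtens_index (i, ord0).
pose g (i : 'I_(tdim V * 1)) : 'I_(tdim V) := (mxtens_unindex i).1.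
apply: (@taft_iso_bij (taft_tens V taft_one)
          V f g) => /=.
- by move=> i; rewrite /f /g mxtens_indexK.
- by move=> i; case: (mxtens_indexP i) => a b; rewrite [b]ord1 /g mxtens_indexK.
- by move=> i j; rewrite tensmxE mxE mulr1.
- by move=> i j; rewrite !addmxE !tensmxE !mxE mulr0 mulr1 add0r.
Qed.

Lemma taft_tensDl U V W : taft_iso (taft_tens (taft_dsum U V) W)
  (taft_dsum (taft_tens U W) (taft_tens V W)).
Proof.
pose g (i : 'I_((tdim U + tdim V) * tdim W)) :
    'I_(tdim U * tdim W + tdim V * tdim W) :=
  let j := mxtens_unindex i in
  match split j.1 with
  | inl a => lshift _ (mxtens_index (a, j.2))
  | inr b => rshift _ (mxtens_index (b, j.2))
  end.
pose f (i : 'I_(tdim U * tdim W + tdim V * tdim W)) :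
    'I_((tdim U + tdim V) * tdim W) :=
  match split i with
  | inl j => let k := mxtens_unindex j in mxtens_index (lshift _ k.1, k.2)
  | inr j => let k := mxtens_unindex j in mxtens_index (rshift _ k.1, k.2)
  end.
have fl a c : f (lshift _ (mxtens_index (a, c))) = mxtens_index (lshift _ a, c).
  by rewrite /f (unsplitK (inl _)) mxtens_indexK.
have fr b c : f (rshift _ (mxtens_index (b, c))) = mxtens_index (rshift _ b, c).
  by rewrite /f (unsplitK (inr _)) mxtens_indexK.
have gl a c : g (mxtens_index (lshift _ a, c)) = lshift _ (mxtens_index (a, c)).
  by rewrite /g mxtens_indexK (unsplitK (inl _)).
have gr b c : g (mxtens_index (rshift _ b, c)) = rshift _ (mxtens_index (b, c)).
  by rewrite /g mxtens_indexK (unsplitK (inr _)).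
have e1 : (1%:M : 'M[K]_(tdim U + tdim V)) = block_mx 1%:M 0 0 1%:M.
  exact: scalar_mx_block.
apply: (@taft_iso_bij (taft_tens (taft_dsum U V) W)
          (taft_dsum (taft_tens U W) (taft_tens V W)) f g) => /=.
- move=> i; case: (split_ordP i) => j ->; case: (mxtens_indexP j) => a c.
    by rewrite fl gl.
  by rewrite fr gr.
- move=> i; case: (mxtens_indexP i) => j c; case: (split_ordP j) => a ->.
    by rewrite gl fl.
  by rewrite gr fr.
- move=> i i'; case: (split_ordP i) => j ->; case: (mxtens_indexP j) => a c;
  case: (split_ordP i') => j' ->; case: (mxtens_indexP j') => a' c';
  rewrite ?(fl, fr) ?(block_mxEul, block_mxEur, block_mxEdl, block_mxEdr);
  rewrite !tensmxE ?(block_mxEul, block_mxEur, block_mxEdl, block_mxEdr);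
  by rewrite ?[(0 : 'M__) _ _]mxE ?mul0r.
- move=> i i'; case: (split_ordP i) => j ->; case: (mxtens_indexP j) => a c;
  case: (split_ordP i') => j' ->; case: (mxtens_indexP j') => a' c';
  rewrite ?(fl, fr) ?(block_mxEul, block_mxEur, block_mxEdl, block_mxEdr);
  rewrite !addmxE !tensmxE e1;
  rewrite ?(block_mxEul, block_mxEur, block_mxEdl, block_mxEdr);
  by rewrite ?[(0 : 'M__) _ _]mxE ?mul0r ?addr0.
Qed.

Lemma taft_tensDr U V W : taft_iso (taft_tens U (taft_dsum V W))
  (taft_dsum (taft_tens U V) (taft_tens U W)).
Proof.
pose g (i : 'I_(tdim U * (tdim V + tdim W))) :
    'I_(tdim U * tdim V + tdim U * tdim W) :=
  let j := mxtens_unindex i in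
  match split j.2 with
  | inl a => lshift _ (mxtens_index (j.1, a))
  | inr b => rshift _ (mxtens_index (j.1, b))
  end.
pose f (i : 'I_(tdim U * tdim V + tdim U * tdim W)) :
    'I_(tdim U * (tdim V + tdim W)) :=
  match split i with
  | inl j => let k := mxtens_unindex j in mxtens_index (k.1, lshift _ k.2)
  | inr j => let k := mxtens_unindex j in mxtens_index (k.1, rshift _ k.2)
  end.
have fl a c : f (lshift _ (mxtens_index (c, a))) = mxtens_index (c, lshift _ a).
  by rewrite /f (unsplitK (inl _)) mxtens_indexK.
have fr b c : f (rshift _ (mxtens_index (c, b))) = mxtens_index (c, rshift _ b).
  by rewrite /f (unsplitK (inr _)) mxtens_indexK.
have gl a c : g (mxtens_index (c, lshift _ a)) = lshift _ (mxtens_index (c, a)).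
  by rewrite /g mxtens_indexK (unsplitK (inl _)).
have gr b c : g (mxtens_index (c, rshift _ b)) = rshift _ (mxtens_index (c, b)).
  by rewrite /g mxtens_indexK (unsplitK (inr _)).
apply: (@taft_iso_bij (taft_tens U (taft_dsum V W))
          (taft_dsum (taft_tens U V) (taft_tens U W)) f g) => /=.
- move=> i; case: (split_ordP i) => j ->; case: (mxtens_indexP j) => a c.
    by rewrite fl gl.
  by rewrite fr gr.
- move=> i; case: (mxtens_indexP i) => c j; case: (split_ordP j) => a ->.
    by rewrite gl fl.
  by rewrite gr fr.
- move=> i i'; case: (split_ordP i) => j ->; case: (mxtens_indexP j) => a c;
  case: (split_ordP i') => j' ->; case: (mxtens_indexP j') => a' c';
  rewrite ?(fl, fr) ?(block_mxEul, block_mxEur, block_mxEdl, block_mxEdr);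
  rewrite !tensmxE ?(block_mxEul, block_mxEur, block_mxEdl, block_mxEdr);
  by rewrite ?[(0 : 'M__) _ _]mxE ?mulr0.
- move=> i i'; case: (split_ordP i) => j ->; case: (mxtens_indexP j) => a c;
  case: (split_ordP i') => j' ->; case: (mxtens_indexP j') => a' c';
  rewrite ?(fl, fr) ?(block_mxEul, block_mxEur, block_mxEdl, block_mxEdr);
  rewrite !addmxE !tensmxE;
  rewrite ?(block_mxEul, block_mxEur, block_mxEdl, block_mxEdr);
  by rewrite ?[(0 : 'M__) _ _]mxE ?mulr0 ?addr0.
Qed.

End TaftModules.

Lemma subrACA (V : zmodType) (u v x y : V) :
  (u - v) - (x - y) = (u - x) - (v - y).
Proof. by rewrite !opprB addrACA [RHS]addrACA [- v - x]addrC. Qed.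

Section GreenRing.
Variables (K : fieldType) (n d : nat) (q : K).
Local Notation taft_mod := (taft_mod n d q).
Local Notation free := {freeg taft_mod / int}.
Implicit Types (U V W : taft_mod) (x y z : free).

(* The subgroup of the free abelian group on the modules generated by the
   relations [V] = [W] for V isomorphic to W and [V (+) W] = [V] + [W]. *)
Inductive green_rel : free -> Prop :=
| green_rel0 : green_rel 0
| green_relB x y : green_rel x -> green_rel y -> green_rel (x - y)
| green_rel_iso V W : taft_iso V W -> green_rel (<<V>> - <<W>>)
| green_rel_dsum V W : green_rel (<<taft_dsum V W>> - (<<V>> + <<W>>)).

Definition green_relb : free -> bool := fun x => `[< green_rel x >].

Lemma green_relb_closed : zmod_closed green_relb.
Proof.
split; first exact/asboolP/green_rel0.
by move=> x y /asboolP x0 /asboolP y0; apply/asboolP/green_relB.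
Qed.

HB.instance Definition _ := GRing.isZmodClosed.Build free green_relb
  green_relb_closed.

Lemma freeg_ind (P : free -> Prop) :
  P 0 -> (forall x y, P x -> P y -> P (x - y)) -> (forall V, P <<V>>) ->
  forall x, P x.
Proof.
move=> P0 PB PV x; rewrite -(freeg_sumE x).
have PN y : P y -> P (- y) by move=> Py; rewrite -[- y]add0r; apply: PB.
have PD y z : P y -> P z -> P (y + z).
  by move=> Py Pz; rewrite -[z]opprK; apply: PB => //; apply: PN.
apply: (big_ind P) => // V _.
have Pn k : P << k%:Z *g V >>.
  elim: k => [|k IH]; first by rewrite freegU0.
  by rewrite intS -freegUD; apply: PD.
by case: (coeff V x) => k //; rewrite NegzE -freegUN; apply: PN.
Qed.

Hypothesis prim_q : d.-primitive_root q.
Local Notation tens := (taft_tens prim_q).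

(* The bilinear extension of the tensor product to the free abelian group. *)
Definition free_mul x y : free :=
  fglift (fun V => fglift (fun W => << tens V W >> : free) y) x.

Lemma fgliftB (M : lmodType int) (f : taft_mod -> M) x y :
  fglift f (x - y) = fglift f x - fglift f y.
Proof. exact: lift_is_additive. Qed.

Lemma fglift0 (M : lmodType int) (f : taft_mod -> M) : fglift f 0 = 0.
Proof. by rewrite -(subrr 0) fgliftB subrr. Qed.

Lemma free_mulU V W : free_mul <<V>> <<W>> = << tens V W >>.
Proof. by rewrite /free_mul !liftU !scale1r. Qed.

Lemma free_mulBl x y z : free_mul (x - y) z = free_mul x z - free_mul y z.
Proof. exact: fgliftB. Qed.

Lemma free_mul0l y : free_mul 0 y = 0.
Proof. exact: fglift0. Qed.

Lemma free_mulBr x y z : free_mul x (y - z) = free_mul x y - free_mul x z.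
Proof.
elim/freeg_ind: x => [|x x' IH IH'|V]; first by rewrite !free_mul0l subrr.
  by rewrite !free_mulBl IH IH' subrACA.
by rewrite /free_mul !liftU !scale1r fgliftB.
Qed.

Lemma free_mul0r x : free_mul x 0 = 0.
Proof. by rewrite -[X in free_mul x X](subrr 0) free_mulBr subrr. Qed.

Lemma free_mulDl x y z : free_mul (x + y) z = free_mul x z + free_mul y z.
Proof.
by rewrite -{1}[y]opprK free_mulBl -[- y]add0r free_mulBl free_mul0l sub0r opprK.
Qed.

Lemma free_mulDr x y z : free_mul x (y + z) = free_mul x y + free_mul x z.
Proof.
by rewrite -{1}[z]opprK free_mulBr -[- z]add0r free_mulBr free_mul0r sub0r opprK.
Qed.

Lemma green_relD x y : green_rel x -> green_rel y -> green_rel (x + y).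
Proof.
move=> x0 y0; rewrite -[y]opprK -[- y]add0r.
by do 2?apply: green_relB => //; apply: green_rel0.
Qed.

Lemma green_rel_mull x y : green_rel y -> green_rel (free_mul x y).
Proof.
move=> y0; elim/freeg_ind: x => [|x x' IH IH'|U].
- by rewrite free_mul0l; apply: green_rel0.
- by rewrite free_mulBl; apply: green_relB.
elim: y0 => [|y1 y2 _ IH1 _ IH2|V W isoVW|V W].
- by rewrite free_mul0r; apply: green_rel0.
- by rewrite free_mulBr; apply: green_relB.
- by rewrite free_mulBr !free_mulU; apply/green_rel_iso/taft_iso_tensr.
rewrite free_mulBr free_mulDr !free_mulU -[X in X - _](subrK
  << taft_dsum (tens U V) (tens U W) >>) -addrA.
apply: green_relD; last exact: green_rel_dsum.
by apply: green_rel_iso; apply: taft_tensDr.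
Qed.

Lemma green_rel_mulr x y : green_rel x -> green_rel (free_mul x y).
Proof.
move=> x0; elim/freeg_ind: y => [|y y' IH IH'|U].
- by rewrite free_mul0r; apply: green_rel0.
- by rewrite free_mulBr; apply: green_relB.
elim: x0 => [|y1 y2 _ IH1 _ IH2|V W isoVW|V W].
- by rewrite free_mul0l; apply: green_rel0.
- by rewrite free_mulBl; apply: green_relB.
- by rewrite free_mulBl !free_mulU; apply/green_rel_iso/taft_iso_tensl.
rewrite free_mulBl free_mulDl !free_mulU -[X in X - _](subrK
  << taft_dsum (tens V U) (tens W U) >>) -addrA.
apply: green_relD; last exact: green_rel_dsum.
by apply: green_rel_iso; apply: taft_tensDl.
Qed.

Lemma green_rel_mulA x y z :
  green_rel (free_mul x (free_mul y z) - free_mul (free_mul x y) z).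
Proof.
elim/freeg_ind: x => [|x x' IH IH'|U].
- by rewrite !free_mul0l subrr; apply: green_rel0.
- by rewrite !free_mulBl subrACA; apply: green_relB.
elim/freeg_ind: y => [|y y' IH IH'|V].
- by rewrite free_mul0r !free_mul0l free_mul0r subrr; apply: green_rel0.
- by rewrite !(free_mulBl, free_mulBr) subrACA; apply: green_relB.
elim/freeg_ind: z => [|z z' IH IH'|W].
- by rewrite !free_mul0r subrr; apply: green_rel0.
- by rewrite !free_mulBr subrACA; apply: green_relB.
rewrite !free_mulU -opprB -sub0r; apply: green_relB; first exact: green_rel0.
by apply: green_rel_iso; apply: taft_tensA.
Qed.

Lemma green_rel_mul1l x : green_rel (free_mul << taft_one n prim_q >> x - x).
Proof.
elim/freeg_ind: x => [|x x' IH IH'|U].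
- by rewrite free_mul0r subrr; apply: green_rel0.
- by rewrite free_mulBr subrACA; apply: green_relB.
by rewrite free_mulU; apply: green_rel_iso; apply: taft_tens1l.
Qed.

Lemma green_rel_mul1r x : green_rel (free_mul x << taft_one n prim_q >> - x).
Proof.
elim/freeg_ind: x => [|x x' IH IH'|U].
- by rewrite free_mul0l subrr; apply: green_rel0.
- by rewrite free_mulBl subrACA; apply: green_relB.
by rewrite free_mulU; apply: green_rel_iso; apply: taft_tens1r.
Qed.

(* The Green ring; the primitivity of q is needed for its multiplication. *)
Definition green_ring of d.-primitive_root q :=
  Quotient.quot (GRing.ZmodClosed.clone _ green_relb _).
Local Notation green := (green_ring prim_q).

HB.instance Definition _ := GRing.Zmodule.on green.
HB.instance Definition _ := Quotient.on green.

Definition green_pi (x : free) : green := \pi_green%qT x.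

Definition green_class V : green := green_pi <<V>>.

Definition green_mul (x y : green) : green :=
  green_pi (free_mul (repr x) (repr y)).

Lemma green_eqP x y :
  reflect (green_rel (x - y)) (green_pi x == green_pi y).
Proof. by rewrite /green_pi -Quotient.idealrBE; apply: asboolP. Qed.

Lemma green_ind (P : green -> Prop) :
  (forall x, P (green_pi x)) -> forall u, P u.
Proof. by move=> Ppi u; rewrite -[u]reprK; apply: Ppi. Qed.

Lemma green_repr_pi x : green_rel (repr (green_pi x) - x).
Proof. by apply/green_eqP; rewrite /green_pi reprK. Qed.

Lemma green_pi_mul x y :
  green_mul (green_pi x) (green_pi y) = green_pi (free_mul x y).
Proof.
apply/eqP/green_eqP; set x' := repr _; set y' := repr _.
have -> : free_mul x' y' - free_mul x y =
    free_mul (x' - x) y' + free_mul x (y' - y).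
  by rewrite free_mulBl free_mulBr addrA subrK.
by apply: green_relD; [apply: green_rel_mulr|apply: green_rel_mull];
   apply: green_repr_pi.
Qed.

Lemma green_piD x y :
  green_pi (x + y) = green_pi x + green_pi y.
Proof. exact: (@Quotient.pi_add _ (GRing.ZmodClosed.clone _ green_relb _)). Qed.

Lemma green_mulA : associative green_mul.
Proof.
elim/green_ind=> x; elim/green_ind=> y; elim/green_ind=> z; rewrite !green_pi_mul.
exact/eqP/green_eqP/green_rel_mulA.
Qed.

Lemma green_mul1l : left_id (green_class (taft_one n prim_q)) green_mul.
Proof.
elim/green_ind=> x; rewrite green_pi_mul.
exact/eqP/green_eqP/green_rel_mul1l.
Qed.

Lemma green_mul1r : right_id (green_class (taft_one n prim_q)) green_mul.
Proof.
elim/green_ind=> x; rewrite green_pi_mul.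
exact/eqP/green_eqP/green_rel_mul1r.
Qed.

Lemma green_mulDl : left_distributive green_mul +%R.
Proof.
elim/green_ind=> x; elim/green_ind=> y; elim/green_ind=> z.
by rewrite -green_piD !green_pi_mul free_mulDl green_piD.
Qed.

Lemma green_mulDr : right_distributive green_mul +%R.
Proof.
elim/green_ind=> x; elim/green_ind=> y; elim/green_ind=> z.
by rewrite -green_piD !green_pi_mul free_mulDr green_piD.
Qed.

HB.instance Definition _ := GRing.Zmodule_isPzRing.Build green
  green_mulA green_mul1l green_mul1r green_mulDl green_mulDr.

Lemma green_classM V W :
  green_class (tens V W) = green_class V * green_class W.
Proof. by rewrite [RHS]green_pi_mul free_mulU. Qed.

Lemma green_class1 : green_class (taft_one n prim_q) = 1.
Proof. by []. Qed.

Lemma green_class_dsum V W :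
  green_class (taft_dsum V W) = green_class V + green_class W.
Proof. by rewrite -green_piD; apply/eqP/green_eqP/green_rel_dsum. Qed.

Lemma green_class_iso V W : taft_iso V W -> green_class V = green_class W.
Proof. by move=> isoVW; apply/eqP/green_eqP/green_rel_iso. Qed.

End GreenRing.

Section IndecomposableModules.
Variables (K : fieldType) (n d : nat) (q w : K).
Hypotheses (dvd_dn : (d %| n)%N) (prim_q : d.-primitive_root q).
Hypothesis prim_w : n.-primitive_root w.

Lemma matrix_diag_exp l (f : 'I_l -> K) k :
  (\matrix_(r, c) (f c *+ (r == c))) ^+ k = \matrix_(r, c) (f c ^+ k *+ (r == c)).
Proof.
elim: k => [|k IH]; first by apply/matrixP => r c; rewrite !mxE.
rewrite exprS IH -mulmxE; apply/matrixP => r c; rewrite !mxE.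
rewrite (bigD1 r) //= big1 => [|s ne_s].
  rewrite !mxE eqxx mulr1n addr0 exprS; case: eqVneq => [->|_] //.
  by rewrite mulr0.
by rewrite !mxE eq_sym (negPf ne_s) mul0r.
Qed.

Lemma matrix_shift_exp l k :
  (\matrix_(r < l, c < l) (r == c.+1 :> nat)%:R : 'M[K]_l) ^+ k =
  \matrix_(r, c) (r == c + k :> nat)%N%:R.
Proof.
elim: k => [|k IH]; first by apply/matrixP => r c; rewrite !mxE addn0.
rewrite exprSr IH -mulmxE; apply/matrixP => r c; rewrite !mxE.
have [lt_c|le_c] := ltnP c.+1 l.
  rewrite (bigD1 (Ordinal lt_c)) //= big1 => [|s ne_s].
    by rewrite !mxE eqxx mulr1 addr0 addSnnS.
  by rewrite !mxE -[s == _ :> nat]/(s == Ordinal lt_c) (negPf ne_s) mulr0.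
rewrite big1 => [|s _].
  by rewrite ltn_eqF // (leq_trans (ltn_ord r)) // (leq_trans le_c) //
    addnS ltnS leq_addr.
by rewrite !mxE (ltn_eqF (leq_trans (ltn_ord s) le_c)) mulr0.
Qed.

(* M(l, i): the basis vector v_j is the j-th standard column vector. *)
Program Definition taft_M l (le_ld : (l <= d)%N) (i : 'Z_n) : taft_mod n d q :=
  @TaftMod K n d q l
    (\matrix_(r, c) ((w ^+ i * q ^- c) *+ (r == c)))
    (\matrix_(r, c) (r == c.+1 :> nat)%:R) _ _ _.
Next Obligation.
rewrite matrix_diag_exp; apply/matrixP => r c; rewrite !mxE.
rewrite exprMn exprAC (prim_expr_order prim_w) expr1n mul1r exprVn exprAC.
by case/dvdnP: dvd_dn => k ->; rewrite mulnC exprM (prim_expr_order prim_q)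
  !expr1n invr1.
Qed.
Next Obligation.
rewrite matrix_shift_exp; apply/matrixP => r c; rewrite !mxE.
by rewrite ltn_eqF // (leq_trans (ltn_ord r)) // (leq_trans le_ld) // leq_addl.
Qed.
Next Obligation.
have q_neq0 : q != 0.
  apply/eqP => q0; have := prim_expr_order prim_q.
  by rewrite q0 expr0n eqn0Ngt (prim_order_gt0 prim_q) => /eqP; rewrite eq_sym oner_eq0.
apply/matrixP => r c; rewrite !mxE (bigD1 c) //= big1 => [|s ne_s]; last first.
  by rewrite !mxE (negPf ne_s) mulr0.
rewrite (bigD1 r) //= big1 => [|s ne_s]; last first.
  by rewrite !mxE eq_sym (negPf ne_s) mul0r.
rewrite !mxE !eqxx !addr0 !mulr1n; case: eqP => [->|_]; last by rewrite !(mul0r, mulr0).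
by rewrite mul1r mulr1 exprS invfM mulrCA mulVKf.
Qed.

End IndecomposableModules.

(* Main.v *)
Require Import Defs.
From mathcomp Require Import all_boot all_order all_algebra.
From mathcomp Require Import boolp classical_sets.
From mathcomp Require Import mxtens freeg.
From mathcomp Require Import ring zify.

Set Implicit Arguments.
Unset Strict Implicit.
Unset Printing Implicit Defensive.

Import GRing.Theory.
Local Open Scope ring_scope.

(* Put a = [M(1,1)], x = [M(2,0)], b = a^m and M_l = [M(l,0)]. The elements
   a^k M_l span the Green ring, x M_l = M_{l+1} + b^-1 M_{l-1} for l < d, and
   x M_d = (1 + b^-1) M_d. So the ring is commutative and finite over Z, and
   theta = (b - 1) M_d, the claimed generator, has square zero since
   M_d^2 = (1 + b^-1 + ... + b^-(d-1)) M_d; hence theta lies in the radical.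
   Conversely a ring morphism f to K kills the radical: its values are integral
   over Z, so a nonzero value would give a radical element with f-value a nonzero
   integer c, and then 1 + c^2 would be invertible among algebraic integers.
   Such a morphism sending a to zeta and x to z exists as soon as zeta^n = 1 and
   (z - 1 - zeta^-m) U_d(z) = 0, where U_l(z), the value of M_l, is a Chebyshev
   polynomial; it is well defined because it is a combination of the ranks of the
   powers of h on the eigenspaces of g. Take y = sum c_{k,l} a^k M_l in the
   radical. The d - 1 distinct roots of U_d force c_{k,l} = 0 for l < d; the
   remaining value z = 1 + zeta^-m, for zeta^m = 1, forces sum_k c_{k,d} a^k to
   be a multiple of b - 1. *)

(** * Splitting off strings *)

Section Splitting.
Variables (K : fieldType) (n d : nat) (q w : K).
Hypotheses (dvd_dn : (d %| n)%N) (prim_q : d.-primitive_root q).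
Hypothesis prim_w : n.-primitive_root w.
Local Notation taft_mod := (taft_mod n d q).
Local Notation M := (taft_M dvd_dn prim_q prim_w).
Implicit Types (U V W : taft_mod).

Lemma prim_root_neq0 N (z : K) : N.-primitive_root z -> z != 0.
Proof.
move=> prim_z; apply/eqP => z0; have := prim_expr_order prim_z.
by move/eqP; rewrite z0 expr0n eqn0Ngt (prim_order_gt0 prim_z) eq_sym oner_eq0.
Qed.

Let q_neq0 : q != 0 := prim_root_neq0 prim_q.

Lemma thX_tg V k : th V ^+ k *m tg V = q ^+ k *: (tg V *m th V ^+ k).
Proof.
elim: k => [|k IH]; first by rewrite !expr0 mulmx1 mul1mx scale1r.
rewrite exprSr -[th V ^+ k * _]/(_ *m _) -mulmxA th_tg -scalemxAr.
by rewrite [in LHS]mulmxA IH -scalemxAl scalerA -exprS exprSr mulmxA.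
Qed.

Definition taft_morph V W (P : 'M[K]_(tdim W, tdim V)) : Prop :=
  P *m tg V = tg W *m P /\ P *m th V = th W *m P.

Definition string_mx V l (v : 'cV_(tdim V)) : 'M_(tdim V, l) :=
  \matrix_(r, c) (th V ^+ c *m v) r 0.

(** A candidate retraction of [string_mx]: [f] is the coordinate on v_(l-1), and the exponents make
    the (r, c) entry of the pairing depend only on c - r. *)
Definition costring_mx V l (f : 'rV_(tdim V)) : 'M_(l, tdim V) :=
  \matrix_(r, c) (f *m th V ^+ (l.-1 - r)) 0 c.

(** M(l,i) is generated by v_0 with the relations g v_0 = w^i v_0 and h^l v_0 = 0, so any vector
    obeying them defines a morphism. *)
Lemma string_mx_morph V l (le_ld : (l <= d)%N) (i : 'Z_n) v :
  tg V *m v = w ^+ i *: v -> th V ^+ l *m v = 0 ->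
  taft_morph (V := M le_ld i) (string_mx l v).
Proof.
move=> gv hv; split; apply/matrixP => r c.
  transitivity ((tg V *m (th V ^+ c *m v)) r 0); last first.
    by rewrite !mxE; apply: eq_bigr => s _; rewrite !mxE.
  have -> : tg V *m (th V ^+ c *m v) = (w ^+ i * q ^- c) *: (th V ^+ c *m v).
    apply: (scalerI (expf_neq0 c q_neq0)).
    rewrite mulmxA [LHS]scalemxAl -thX_tg -mulmxA gv -scalemxAr scalerA.
    by rewrite mulrCA divff ?expf_neq0 // mulr1.
  rewrite !mxE (bigD1 c) //= big1 => [|s ne_s]; last first.
    by rewrite !mxE (negPf ne_s) mulr0n mulr0.
  by rewrite !mxE eqxx addr0 mulr1n mulrC.
transitivity ((th V ^+ c.+1 *m v) r 0); last first.
  rewrite exprS -[th V * _]/(th V *m _) -mulmxA !mxE.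
  by apply: eq_bigr => s _; rewrite !mxE.
have [lt_c|le_c] := ltnP c.+1 l.
  rewrite !mxE (bigD1 (Ordinal lt_c)) //= big1 => [|s ne_s]; last first.
    by rewrite !mxE -[s == _ :> nat]/(s == Ordinal lt_c) (negPf ne_s) mulr0.
  by rewrite !mxE /= eqxx mulr1 addr0.
have <- : l = c.+1 by apply/eqP; rewrite eqn_leq le_c ltn_ord.
rewrite hv !mxE big1 // => s _; rewrite !mxE.
by rewrite (ltn_eqF (leq_trans (ltn_ord s) le_c)) mulr0.
Qed.

(** Dual to [string_mx_morph]: the coordinate functional of v_(l-1) generates the dual of M(l,i),
    and its weight is that of v_(l-1). *)
Lemma costring_mx_morph V l (le_ld : (l <= d)%N) (i : 'Z_n) f :
  (0 < l)%N ->
  f *m tg V = (w ^+ i * q ^- l.-1) *: f -> f *m th V ^+ l = 0 ->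
  taft_morph (W := M le_ld i) (costring_mx l f).
Proof.
move=> l_gt0 fg fh; split; apply/matrixP => r c.
  transitivity ((f *m th V ^+ (l.-1 - r) *m tg V) 0 c).
    by rewrite !mxE; apply: eq_bigr => s _; rewrite !mxE.
  have le_r : (r <= l.-1)%N by rewrite -ltnS prednK.
  have -> : f *m th V ^+ (l.-1 - r) *m tg V =
      (w ^+ i * q ^- r) *: (f *m th V ^+ (l.-1 - r)).
    rewrite -mulmxA thX_tg -scalemxAr mulmxA fg -scalemxAl scalerA.
    congr (_ *: _); rewrite mulrCA; congr (_ * _).
    rewrite -{2}(subnK le_r) exprD invfM mulrA divff ?mul1r //.
    by rewrite expf_neq0.
  rewrite [RHS]mxE (bigD1 r) //= big1 => [|s ne_s]; last first.
    by rewrite !mxE eq_sym (negPf ne_s) mulr0n mul0r.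
  rewrite addr0 [LHS]mxE; congr (_ * _); last by rewrite [RHS]mxE.
  by rewrite mxE eqxx mulr1n.
transitivity ((f *m th V ^+ (l.-1 - r).+1) 0 c).
  rewrite exprSr -[_ * th V]/(_ *m th V) mulmxA !mxE.
  by apply: eq_bigr => s _; rewrite !mxE.
have [r0|r_gt0] := posnP r.
  rewrite r0 subn0 prednK // fh [RHS]mxE big1 ?mxE // => s _.
  by rewrite !mxE r0 mul0r.
have lt_r : (r.-1 < l)%N by rewrite (leq_trans _ (ltn_ord r)) // ltnS leq_pred.
rewrite [RHS]mxE (bigD1 (Ordinal lt_r)) //= big1 => [|s ne_s]; last first.
  rewrite !mxE; case: eqP => [rs|_]; last by rewrite mul0r.
  by case/eqP: ne_s; apply: val_inj; rewrite /= rs.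
have le_r : (r <= l.-1)%N by rewrite -ltnS prednK.
have -> : ((l.-1 - r).+1 = l.-1 - r.-1)%N.
  by rewrite -subSn // -[in LHS](prednK r_gt0) subSS.
by rewrite addr0 [in RHS]mxE /= prednK // eqxx mul1r [RHS]mxE.
Qed.

Definition taft_summand U V : Prop :=
  exists (P : 'M_(tdim V, tdim U)) (Q : 'M_(tdim U, tdim V)),
    [/\ taft_morph P, taft_morph Q & Q *m P = 1%:M].

Lemma costring_stringE V l l' f v (r : 'I_l) (c : 'I_l') :
  (costring_mx l f *m string_mx l' v) r c =
  (f *m th V ^+ (l.-1 - r + c) *m v) 0 0.
Proof.
rewrite exprD -[_ * _]/(_ *m _) !mulmxA -mulmxA !mxE; apply: eq_bigr => s _.
by rewrite !mxE.
Qed.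

(* The weights of [th V ^+ s *m v], [s < d], are pairwise distinct, so [f] kills
   all of them but [th V ^+ l.-1 *m v]: the pairing matrix is the identity. *)
Lemma costring_string V l (le_ld : (l <= d)%N) (i : 'Z_n) v f mu :
  (0 < l)%N -> tg V *m v = w ^+ i *: v -> th V ^+ l *m v = 0 ->
  f *m tg V = mu *: f -> f *m th V ^+ l.-1 *m v = 1%:M ->
  mu = w ^+ i * q ^- l.-1 /\ costring_mx l f *m string_mx l v = 1%:M.
Proof.
move=> l_gt0 gv hv fg fv.
(* Moving g across h^k in f h^k g v: f h^k v can be nonzero only when q^k mu = w^i. *)
have fhk k : (q ^+ k * mu) *: (f *m th V ^+ k *m v) =
     w ^+ i *: (f *m th V ^+ k *m v).
  rewrite -scalerA [mu *: _]scalemxAl [mu *: _]scalemxAl -fg scalemxAl.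
  by rewrite -[f *m _ *m _]mulmxA scalemxAr -thX_tg -!mulmxA gv -!scalemxAr.
have muE : mu = w ^+ i * q ^- l.-1.
  have := fhk l.-1; rewrite fv => /matrixP/(_ 0 0); rewrite !mxE !mulr1 => <-.
  by rewrite mulrC mulrA mulVf ?mul1r // expf_neq0.
split=> //; apply/matrixP => r c.
rewrite costring_stringE.
have le_r : (r <= l.-1)%N by rewrite -ltnS prednK.
case: (ltngtP c r) => [lt_cr|lt_rc|e_cr]; last first.
- by rewrite e_cr subnK // fv !mxE (val_inj e_cr) !eqxx.
- have [s ->] : exists s, (l.-1 - r + c = s + l)%N.
    by exists (c - r).-1; lia.
  rewrite exprD -[_ * th V ^+ l]/(_ *m _) -!mulmxA hv !mulmx0 !mxE.
  by rewrite -(inj_eq val_inj) /= (ltn_eqF lt_rc).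
set k := (_ + _)%N; have kE : (k + (r - c) = l.-1)%N.
  by rewrite /k -addnA subnKC ?subnK // ltnW.
rewrite [RHS]mxE -(inj_eq val_inj) /= (gtn_eqF lt_cr).
have /matrixP/(_ 0 0) := fhk k; rewrite [LHS]mxE [RHS]mxE => e.
apply/eqP; move/eqP: e; rewrite -subr_eq0 -mulrBl mulf_eq0 => /orP[|//].
rewrite muE mulrCA -[X in _ - X]mulr1 -mulrBr mulf_eq0 expf_eq0.
rewrite (negPf (prim_root_neq0 prim_w)) andbF /= -kE exprD invfM mulrA.
rewrite divff ?expf_neq0 // mul1r subr_eq0 -invr1 (inj_eq invr_inj).
rewrite -(prim_order_dvd prim_q) => /dvdn_leq; rewrite subn_gt0 lt_cr => /(_ isT).
have lt_rd : (r < d)%N := leq_trans (ltn_ord r) le_ld.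
by rewrite leqNgt (leq_ltn_trans (leq_subr _ _) lt_rd).
Qed.

Lemma taft_M_summand V l (le_ld : (l <= d)%N) (i : 'Z_n)
    (v : 'cV_(tdim V)) (f : 'rV_(tdim V)) mu :
  (0 < l)%N -> tg V *m v = w ^+ i *: v -> th V ^+ l *m v = 0 ->
  f *m tg V = mu *: f -> f *m th V ^+ l = 0 ->
  f *m th V ^+ l.-1 *m v = 1%:M -> taft_summand (M le_ld i) V.
Proof.
move=> l_gt0 gv hv fg fh fv.
have [muE QP] := costring_string le_ld l_gt0 gv hv fg fv.
exists (string_mx l v), (costring_mx l f); split=> //.
  exact: string_mx_morph.
by apply: costring_mx_morph; rewrite -?muE.
Qed.

Lemma mulmx1C_eq k l (A : 'M[K]_(k, l)) (B : 'M_(l, k)) :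
  k = l -> A *m B = 1%:M -> B *m A = 1%:M.
Proof. by move=> e; case: l / e A B => A B; apply: mulmx1C. Qed.

Lemma taft_iso_morph V W (P : 'M_(tdim W, tdim V)) (Q : 'M_(tdim V, tdim W)) :
  taft_morph P -> Q *m P = 1%:M -> tdim V = tdim W -> taft_iso V W.
Proof.
by move=> [Pg Ph] QP e; exists P, Q; split=> //; apply: mulmx1C_eq QP.
Qed.

(** Since [Q2 *m P1 = 0], the pairing of (Q1, Q2) with (P1, P2) is block unitriangular; correcting
    [Q1] by [Q1 *m P2 *m Q2] gives a left inverse, two-sided by the dimension count. *)
Lemma taft_iso_dsum U W V P1 Q1 P2 Q2 :
  taft_morph (V := U) (W := V) P1 -> taft_morph (V := W) (W := V) P2 ->
  Q1 *m P1 = 1%:M -> Q2 *m P2 = 1%:M -> Q2 *m P1 = 0 ->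
  tdim V = (tdim U + tdim W)%N -> taft_iso (taft_dsum U W) V.
Proof.
move=> [P1g P1h] [P2g P2h] QP1 QP2 QP21 dimV.
pose P : 'M_(tdim V, tdim (taft_dsum U W)) := row_mx P1 P2.
pose Q : 'M_(tdim (taft_dsum U W), tdim V) := col_mx (Q1 - Q1 *m P2 *m Q2) Q2.
apply: (@taft_iso_morph _ _ P Q) => //.
- split; rewrite /P /= mul_row_block mul_mx_row !mulmx0 addr0 add0r.
    by rewrite P1g P2g.
  by rewrite P1h P2h.
- rewrite /P /Q mul_col_row mulmxBl mulmxBl -!mulmxA QP1 QP2 QP21.
  by rewrite !mulmx0 !mulmx1 subr0 subrr -scalar_mx_block.
Qed.

(** The idempotent [1%:M - P *m Q] commutes with g and h; a full-rank factorization [S *m T] of it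
    carries the action to a space whose dimension is its rank, the complement. *)
Lemma taft_summand_compl U V : taft_summand U V ->
  exists W, [/\ (tdim U + tdim W = tdim V)%N & taft_iso (taft_dsum U W) V].
Proof.
move=> [P [Q [[Pg Ph] [Qg Qh] QP]]].
pose E := 1%:M - P *m Q.
have EE : E *m E = E.
  rewrite /E mulmxBl mul1mx mulmxBr mulmx1 -!mulmxA (mulmxA Q) QP mul1mx.
  by rewrite subrr subr0.
have Eg : E *m tg V = tg V *m E.
  by rewrite /E mulmxBl mulmxBr mul1mx mulmx1 mulmxA -Pg -!mulmxA Qg.
have Eh : E *m th V = th V *m E.
  by rewrite /E mulmxBl mulmxBr mul1mx mulmx1 mulmxA -Ph -!mulmxA Qh.
have STST k (S : 'M_(tdim V, k)) T : S *m T = E -> S *m (T *m S) *m T = S *m T.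
  by move=> ST; rewrite mulmxA ST -mulmxA ST EE.
(* [T *m S = 1%:M] comes from cancelling [S] on the left and [T] on the right in S (T S) T = S T. *)
have [k [S [T [ST TS]]]] : exists k (S : 'M_(tdim V, k)) (T : 'M_(k, tdim V)),
    S *m T = E /\ T *m S = 1%:M.
  exists (\rank E), (col_base E), (row_base E); split; first exact: mulmx_base.
  apply: (row_full_inj (col_base_full E)); apply: (row_free_inj (row_base_free E)).
  by rewrite mulmx1; apply: STST; apply: mulmx_base.
have TE : T *m E = T by rewrite -ST mulmxA TS mul1mx.
have ES : E *m S = S by rewrite -ST -mulmxA TS mulmx1.
have TXS (X Y : 'M_(tdim V)) : E *m Y = Y *m E ->
    (T *m X *m S) *m (T *m Y *m S) = T *m (X *m Y) *m S.
  move=> EY; rewrite -!mulmxA (mulmxA S T) ST (mulmxA E) EY.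
  by rewrite -(mulmxA Y) ES !mulmxA.
have TXSX (X : 'M_(tdim V)) j : E *m X = X *m E ->
    (T *m X *m S) ^+ j = T *m X ^+ j *m S.
  move=> EX; elim: j => [|j IH]; first by rewrite !expr0 mulmx1 TS.
  rewrite exprSr IH -[_ * _]/(_ *m _ *m (_ *m _)) TXS //.
  by rewrite exprSr.
have gn : (T *m tg V *m S) ^+ n = 1 by rewrite TXSX // tg_exp mulmx1 TS.
have hd : (T *m th V *m S) ^+ d = 0 by rewrite TXSX // th_exp mulmx0 mul0mx.
have hg : (T *m th V *m S) *m (T *m tg V *m S) =
    q *: ((T *m tg V *m S) *m (T *m th V *m S)).
  by rewrite !TXS // th_tg -scalemxAr -scalemxAl.
pose W := TaftMod gn hd hg.
have TP : T *m P = 0.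
  by rewrite -TE -mulmxA /E mulmxBl mul1mx -mulmxA QP mulmx1 subrr mulmx0.
(* The column of [Q], [T] and the row of [P], [S] are inverse on both sides, which bounds each
   dimension by the other. *)
have dimV : (tdim U + tdim W)%N = tdim V.
  have QS : Q *m S = 0.
    by rewrite -ES mulmxA /E mulmxBr mulmx1 mulmxA QP mul1mx subrr mul0mx.
  apply/eqP; rewrite eqn_leq; apply/andP; split.
    apply: (@mulmx1_min _ _ _ (col_mx Q T) (row_mx P S)).
    by rewrite mul_col_row QP TP QS TS -scalar_mx_block.
  apply: (@mulmx1_min _ _ _ (row_mx P S) (col_mx Q T)).
  by rewrite mul_row_col ST /E addrC subrK.
exists W; split=> //.
apply: (@taft_iso_dsum U W V P Q S T) => //; split=> /=.
  by rewrite !mulmxA ST Eg -mulmxA ES.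
by rewrite !mulmxA ST Eh -mulmxA ES.
Qed.

Lemma taft_iso_dsum_M V l1 l2 (le_l1 : (l1 <= d)%N) (le_l2 : (l2 <= d)%N)
    (i1 i2 : 'Z_n) (v1 v2 : 'cV_(tdim V)) (f1 f2 : 'rV_(tdim V)) mu1 mu2 :
  (0 < l1)%N -> tg V *m v1 = w ^+ i1 *: v1 -> th V ^+ l1 *m v1 = 0 ->
  f1 *m tg V = mu1 *: f1 -> f1 *m th V ^+ l1.-1 *m v1 = 1%:M ->
  (0 < l2)%N -> tg V *m v2 = w ^+ i2 *: v2 -> th V ^+ l2 *m v2 = 0 ->
  f2 *m tg V = mu2 *: f2 -> f2 *m th V ^+ l2.-1 *m v2 = 1%:M ->
  (forall k, f2 *m th V ^+ k *m v1 = 0) -> tdim V = (l1 + l2)%N ->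
  taft_iso (taft_dsum (M le_l1 i1) (M le_l2 i2)) V.
Proof.
move=> l1_gt0 gv1 hv1 fg1 fv1 l2_gt0 gv2 hv2 fg2 fv2 fv21 dimV.
have [_ QP1] := costring_string le_l1 l1_gt0 gv1 hv1 fg1 fv1.
have [_ QP2] := costring_string le_l2 l2_gt0 gv2 hv2 fg2 fv2.
apply: (taft_iso_dsum (U := M le_l1 i1) (W := M le_l2 i2)
  (P1 := string_mx l1 v1) (Q1 := costring_mx l1 f1)
  (P2 := string_mx l2 v2) (Q2 := costring_mx l2 f2)) => //.
- exact: string_mx_morph.
- exact: string_mx_morph.
by apply/matrixP => r c; rewrite costring_stringE fv21 !mxE.
Qed.

End Splitting.

(** * Weight projections and generators of the Green ring *)

Section Spanning.
Variables (K : fieldType) (n d : nat) (q w : K).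
Hypotheses (dvd_dn : (d %| n)%N) (prim_q : d.-primitive_root q).
Hypothesis prim_w : n.-primitive_root w.
Hypothesis n_gt1 : (1 < n)%N.
Hypothesis n_neq0 : n%:R != 0 :> K.
Local Notation taft_mod := (taft_mod n d q).
Local Notation M := (taft_M dvd_dn prim_q prim_w).
Local Notation pi := (@green_pi K n d q prim_q).
Local Notation cls := (@green_class K n d q prim_q).
Implicit Types (U V W : taft_mod).

Let w_neq0 : w != 0 := prim_root_neq0 prim_w.

Lemma sum_unity_root (z : K) :
  z ^+ n = 1 -> \sum_(j < n) z ^+ j = (n * (z == 1%R))%N%:R.
Proof.
move=> zn; case: eqP => [->|/eqP z_neq1].
  rewrite muln1 -[n in RHS]card_ord -sumr_const.
  by apply: eq_bigr => i _; rewrite expr1n.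
rewrite muln0; apply: (mulfI (_ : z - 1 != 0)); first by rewrite subr_eq0.
by rewrite -subrX1 zn subrr mulr0.
Qed.

Lemma sum_ord_cyclic (A : zmodType) (F : nat -> A) N :
  F N = F 0%N -> \sum_(j < N) F j.+1 = \sum_(j < N) F j.
Proof.
case: N => [|N] FN; first by rewrite !big_ord0.
by rewrite big_ord_recr big_ord_recl /= FN addrC.
Qed.

(** The discrete Fourier formula for the projection onto the w^k-eigenspace of g. *)
Definition weight_proj V k : 'M_(tdim V) :=
  n%:R^-1 *: \sum_(j < n) w ^- (k * j) *: tg V ^+ j.

Lemma weight_proj_eigen V k a (v : 'cV_(tdim V)) :
  a ^+ n = 1 -> tg V *m v = a *: v ->
  weight_proj V k *m v = (a == w ^+ k)%:R *: v.
Proof.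
move=> an gv.
have gXv j : tg V ^+ j *m v = a ^+ j *: v.
  elim: j => [|j IH]; first by rewrite mul1mx scale1r.
  by rewrite exprSr -[_ * _]/(_ *m _) -mulmxA gv -scalemxAr IH scalerA exprS.
rewrite /weight_proj -scalemxAl mulmx_suml.
under eq_bigr => j _ do rewrite -scalemxAl gXv scalerA exprM -exprVn -exprMn.
rewrite -scaler_suml sum_unity_root; last first.
  by rewrite exprMn an exprVn exprAC (prim_expr_order prim_w) expr1n invr1 mulr1.
rewrite -(inj_eq (mulfI (expf_neq0 k w_neq0))) mulr1 mulVKf ?expf_neq0 //.
by rewrite natrM scalerA mulrA mulVf // mul1r.
Qed.

Lemma tg_weight_proj V k : tg V *m weight_proj V k = w ^+ k *: weight_proj V k.
Proof.
pose F j := w ^- (k * j) *: tg V ^+ j.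
(* Multiplying by g shifts the terms cyclically, because g^n = 1 and w^n = 1. *)
have F_shift : \sum_(j < n) F j.+1 = \sum_(j < n) F j.
  apply: sum_ord_cyclic; rewrite /F tg_exp muln0 mulnC exprM.
  by rewrite (prim_expr_order prim_w) expr1n !expr0.
rewrite /weight_proj -/(\sum_(j < n) F j) -scalemxAr scalerA mulrC -scalerA.
congr (_ *: _); rewrite -[in RHS]F_shift mulmx_sumr scaler_sumr.
apply: eq_bigr => j _.
rewrite /F -scalemxAr scalerA -[tg V *m _]/(_ * _) -exprS; congr (_ *: _).
by rewrite mulnS exprD invfM mulrA divff ?mul1r // expf_neq0.
Qed.

Lemma comm_weight_proj V k : weight_proj V k *m tg V = tg V *m weight_proj V k.
Proof.
rewrite /weight_proj -scalemxAr -scalemxAl mulmx_sumr mulmx_suml.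
congr (_ *: _); apply: eq_bigr => j _; rewrite -scalemxAr -scalemxAl.
by congr (_ *: _); rewrite -[LHS]/(_ * _) -exprSr exprS.
Qed.

Lemma sum_weight_proj V : \sum_(k < n) weight_proj V k = 1%:M.
Proof.
(* After exchanging the sums, orthogonality of characters leaves only the term j = 0. *)
rewrite -scaler_sumr exchange_big /=.
have n_gt0 := prim_order_gt0 prim_w.
rewrite (bigD1 (Ordinal n_gt0)) //= [X in _ + X]big1 => [|j ne_j0].
  under eq_bigr => k _ do rewrite muln0 expr0 invr1 scale1r.
  rewrite sumr_const card_ord addr0 -[X in _ *: X]scaler_nat scalerA mulVf //.
  by rewrite scale1r.
rewrite -scaler_suml.
under eq_bigr => k _ do rewrite mulnC exprM -exprVn.
rewrite sum_unity_root; last first.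
  by rewrite exprVn exprAC (prim_expr_order prim_w) expr1n invr1.
rewrite -invr1 (inj_eq invr_inj) -(prim_order_dvd prim_w).
rewrite /dvdn modn_small // -[_ == _]/(j == Ordinal n_gt0) (negPf ne_j0).
by rewrite muln0 scale0r.
Qed.

(** Here V (+) V is isomorphic to V, so the class equals its double. *)
Lemma green_class_dim0 V : tdim V = 0%N -> cls V = 0.
Proof.
move=> V0; apply: (addrI (cls V)); rewrite addr0 -green_class_dsum.
have noI N : N = 0%N -> 'I_N -> False by move=> ->; case.
have dim0 : tdim (taft_dsum V V) = 0%N by rewrite /= V0.
apply: green_class_iso; exists 0, 0.
by split; apply/matrixP => i j; exfalso; first [exact: (noI _ V0 i) |
  exact: (noI _ dim0 i) | exact: (noI _ V0 j) | exact: (noI _ dim0 j)].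
Qed.

(** With l the nilpotency index of h on V, a nonzero entry of a weight component of h^(l-1) supplies
    [v] and [f] with f h^(l-1) v = 1, so a longest string splits off. *)
Lemma taft_M_summand_ex V : (0 < tdim V)%N ->
  exists l (le_ld : (l <= d)%N) i, (0 < l)%N /\ taft_summand (M le_ld i) V.
Proof.
move=> V_gt0.
have ex_l : exists l, th V ^+ l == 0 by exists d; rewrite th_exp.
case: (ex_minnP ex_l) => l /eqP hl lmin.
have le_ld : (l <= d)%N by apply: lmin; rewrite th_exp.
have l_gt0 : (0 < l)%N.
  rewrite lt0n; apply/eqP => l0; move: hl; rewrite l0 => /matrixP.
  by move=> /(_ (Ordinal V_gt0) (Ordinal V_gt0)) /eqP; rewrite !mxE eqxx oner_eq0.
have : th V ^+ l.-1 != 0.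
  by apply/negP => /lmin; rewrite leqNgt prednK // leqnn.
have hE : th V ^+ l.-1 = \sum_(k' < n) \sum_(k < n)
    weight_proj V k' *m th V ^+ l.-1 *m weight_proj V k.
  rewrite -[LHS]mul1mx -sum_weight_proj mulmx_suml; apply: eq_bigr => k' _.
  by rewrite -[LHS]mulmx1 -sum_weight_proj mulmx_sumr.
have [/existsP[k' /existsP[k nz]] _|] := boolP [exists k' : 'I_n, exists k : 'I_n,
    weight_proj V k' *m th V ^+ l.-1 *m weight_proj V k != 0]; last first.
  move=> /existsPn h0; rewrite hE big1 ?eqxx // => k' _; rewrite big1 // => k _.
  by have /existsPn/(_ k) := h0 k'; rewrite negbK => /eqP.
have /existsP[r /existsP[c nzrc]] : [exists r, exists c,
    (weight_proj V k' *m th V ^+ l.-1 *m weight_proj V k) r c != 0].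
  apply: contraNT nz => /existsPn h0; apply/eqP/matrixP => r c; rewrite [RHS]mxE.
  by apply/eqP; have /existsPn/(_ c) := h0 r; rewrite negbK.
set y := (X in X != 0) in nzrc.
pose v := col c (weight_proj V k).
pose f := y^-1 *: row r (weight_proj V k').
exists l, le_ld, (k : nat)%:R; split=> //.
apply: (@taft_M_summand _ _ _ _ _ _ _ _ V l _ _ v f (w ^+ k')) => //.
- rewrite /v !colE mulmxA tg_weight_proj -scalemxAl; congr (_ *: _).
  by rewrite val_Zp_nat // (prim_expr_mod prim_w).
- by rewrite hl mul0mx.
- rewrite /f -scalemxAl !rowE -mulmxA comm_weight_proj tg_weight_proj -scalemxAr.
  by rewrite !scalerA mulrC.
- by rewrite hl mulmx0.
have rowcol k1 k2 (A : 'M[K]_(k1, k2)) (B : 'M_(k2, k1)) r' c' :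
    (row r' A *m col c' B) 0 0 = (A *m B) r' c'.
  by rewrite !mxE; apply: eq_bigr => s _; rewrite !mxE.
rewrite /f /v -!scalemxAl -row_mul; apply/matrixP => i j.
by rewrite !ord1 mxE rowcol -/y mulVf // mxE.
Qed.

(** Induction on the dimension, splitting off one M(l,i) at a time. *)
Lemma green_span (P : green_ring n prim_q -> Prop) :
  (forall x y, P x -> P y -> P (x - y)) ->
  (forall l (le_ld : (l <= d)%N) i, (0 < l)%N -> P (cls (M le_ld i))) ->
  forall x, P x.
Proof.
move=> PB PM.
have P0 : P 0.
  have d_gt0 := prim_order_gt0 prim_q.
  by rewrite -(subrr (cls (M (leqnn d) 0))); apply: PB; apply: PM.
have PD x y : P x -> P y -> P (x + y).
  move=> Px Py; have PNy : P (- y) by rewrite -sub0r; apply: PB.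
  by rewrite -[y]opprK; apply: PB.
have PV N V : (tdim V < N)%N -> P (cls V).
  elim: N V => // N IH V ltVN.
  have [/green_class_dim0 -> //|V_gt0] := posnP (tdim V).
  have [l [le_ld [i [l_gt0 /taft_summand_compl]]]] := taft_M_summand_ex V_gt0.
  case=> W [dimW /(green_class_iso prim_q) <-]; rewrite green_class_dsum.
  by apply: PD; [apply: PM|apply: IH; move: dimW ltVN l_gt0 => /=; lia].
elim/green_ind; elim/freeg_ind => [|x y Px Py|V]; last exact: PV (leqnn _).
  have -> // : pi 0 = 0.
  by apply: (addrI (pi 0)); rewrite -green_piD !addr0.
have -> : pi (x - y) = pi x - pi y.
  by apply/eqP; rewrite eq_sym subr_eq -green_piD subrK.
exact: PB.
Qed.

End Spanning.

(** * Tensor products with M(2,0) *)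

Section Fusion.
Variables (K : fieldType) (n d : nat) (q w : K).
Hypotheses (dvd_dn : (d %| n)%N) (prim_q : d.-primitive_root q).
Hypothesis prim_w : n.-primitive_root w.
Hypothesis d_gt1 : (1 < d)%N.
Local Notation taft_mod := (taft_mod n d q).
Local Notation M := (taft_M dvd_dn prim_q prim_w).
Local Notation tens := (taft_tens prim_q).
Implicit Types (U V W : taft_mod).

Let q_neq0 : q != 0 := prim_root_neq0 prim_q.
Let w_neq0 : w != 0 := prim_root_neq0 prim_w.

Lemma qint_neq0 k : (0 < k < d)%N -> qint q k != 0.
Proof.
case/andP=> k_gt0 lt_kd; apply/eqP => qk0.
have : q ^+ k == 1 by rewrite -subr_eq0 subrX1 -/(qint q k) qk0 mulr0.
rewrite -(prim_order_dvd prim_q) => /(dvdn_leq k_gt0).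
by rewrite leqNgt lt_kd.
Qed.

Lemma taft_tens_M1 l (le_ld : (l <= d)%N) (le_1d : (1 <= d)%N) (i j k : 'Z_n) :
  w ^+ i * w ^+ j = w ^+ k ->
  taft_iso (tens (M le_1d i) (M le_ld j)) (M le_ld k).
Proof.
move=> wk.
pose f (c : 'I_l) : 'I_(1 * l) := mxtens_index (ord0, c).
pose g (c : 'I_(1 * l)) : 'I_l := (mxtens_unindex c).2.
apply: (@taft_iso_bij _ _ _ _ (tens (M le_1d i) (M le_ld j)) (M le_ld k) f g).
- by move=> c; rewrite /f /g mxtens_indexK.
- by move=> c; case: (mxtens_indexP c) => a b; rewrite [a]ord1 /g mxtens_indexK.
- move=> r c; rewrite tensmxE !mxE eqxx mulr1n expr0 invr1 mulr1 -wk.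
  by rewrite -mulrA mulrnAr.
- by move=> r c; rewrite addmxE !tensmxE !mxE /= mul0r addr0 mul1r.
Qed.

Lemma taft_M_one (le_1d : (1 <= d)%N) : taft_iso (M le_1d 0) (taft_one n prim_q).
Proof.
apply: (@taft_iso_bij _ _ _ _ (M le_1d 0) (taft_one n prim_q) id id) => // r c.
  by rewrite !ord1 !mxE /= !expr0 invr1 mulr1.
by rewrite !ord1 !mxE.
Qed.

Variables (l : nat) (le_ld : (l <= d)%N) (i i' : 'Z_n).
Hypothesis l_gt0 : (0 < l)%N.
Hypothesis wi' : w ^+ i' = w ^+ i / q.
Let V := tens (M d_gt1 0) (M le_ld i).

Definition tens2_idx (a : 'I_2) (c : 'I_l) : 'I_(2 * l) := mxtens_index (a, c).
Local Notation mi := tens2_idx.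

Lemma tg_tens2 b r a c :
  tg V (mi b r) (mi a c) = (w ^+ i * q ^- (a + c)) *+ ((b == a) && (r == c)).
Proof.
rewrite tensmxE !mxE /= expr0 mul1r; case: (b == a); case: (r == c) => /=;
  rewrite ?mulr0n ?mulr0 ?mul0r // !mulr1n.
by rewrite exprD invfM; ring.
Qed.

(* On M(2,0) (x) W one has h^k = 1 (x) h^k + (k)_q h (x) g h^(k-1). *)
Lemma th_tens2 k b r a c :
  (th V ^+ k) (mi b r) (mi a c) =
  (b == a)%:R * (r == c + k :> nat)%N%:R +
  qint q k * ((b == 1 :> nat) && (a == 0 :> nat))%:R * (w ^+ i * q ^- r) *
    (r.+1 == c + k :> nat)%N%:R.
Proof.
pose N : 'M[K]_2 := th (M d_gt1 0).
pose g : 'M[K]_l := tg (M le_ld i); pose h : 'M[K]_l := th (M le_ld i).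
have NN : N *m N = 0.
  have := matrix_shift_exp K 2 2; rewrite expr2 -[_ * _]/(N *m N) => ->.
  by apply/matrixP => x y; rewrite !mxE; case: x y => [[|[|]]] // ? [[|[|]]].
have hX j : th V ^+ j.+1 = (1%:M : 'M_2) *t h ^+ j.+1 + qint q j.+1 *: (N *t (g *m h ^+ j)).
  elim: j => [|j IH].
    by rewrite !expr1 expr0 mulmx1 /qint big_ord1 expr0 scale1r.
  rewrite exprSr IH -[_ * th V]/(_ *m (1%:M *t h + N *t g)).
  rewrite mulmxDr !mulmxDl -!scalemxAl !tensmx_mul NN tens0mx scaler0 addr0.
  rewrite !mul1mx !mulmx1 -[h ^+ j.+1 *m h]exprSr -addrA; congr (_ + _).
  rewrite /h /g thX_tg -mulmxA -[h ^+ j *m h]exprSr (qintSr q j.+1) scalerDl; congr (_ + _).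
  by rewrite tensmxZr.
case: k => [|k].
  rewrite expr0 qint0 !mul0r addr0 addn0 !mxE (can_eq (@mxtens_indexK _ _)).
  by rewrite xpair_eqE -natrM mulnb.
rewrite hX /tens2_idx addmxE tensmxE [X in _ + X]mxE tensmxE; congr (_ + _).
  by rewrite /h matrix_shift_exp !mxE.
rewrite -!mulrA; congr (_ * _).
have -> : (g *m h ^+ k) r c = (w ^+ i * q ^- r) * (r == c + k :> nat)%N%:R.
  rewrite mxE (bigD1 r) //= big1 => [|s ne_s]; last first.
    by rewrite mxE eq_sym (negPf ne_s) mul0r.
  by rewrite addr0 /h matrix_shift_exp !mxE eqxx mulr1n.
rewrite addnS eqSS mxE; congr (_ * _).
  by case: b a => [[|[|]]] // ? [[|[|]]].
by rewrite mulrA.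
Qed.

Definition tens2_col a c : 'cV[K]_(tdim V) := delta_mx (mi a c) 0.
Definition tens2_row a c : 'rV[K]_(tdim V) := delta_mx 0 (mi a c).

Lemma tens2_row_col (A : 'M_(tdim V)) b r a c :
  tens2_row b r *m A *m tens2_col a c = (A (mi b r) (mi a c))%:M.
Proof.
rewrite /tens2_row /tens2_col -rowE -colE; apply/matrixP => x y.
by rewrite !ord1 [LHS]mxE [LHS]mxE [RHS]mxE.
Qed.

Lemma tg_tens2_col a c :
  tg V *m tens2_col a c = (w ^+ i * q ^- (a + c)) *: tens2_col a c.
Proof.
apply/matrixP => x y; rewrite /tens2_col -colE [LHS]mxE [RHS]mxE
  [X in _ * X]mxE ord1 /= andbT.
case: (mxtens_indexP x) => b r; rewrite -/(mi b r) tg_tens2.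
rewrite (can_eq (@mxtens_indexK _ _)) xpair_eqE.
by rewrite mulr_natr.
Qed.

Lemma tg_tens2_row a c :
  tens2_row a c *m tg V = (w ^+ i * q ^- (a + c)) *: tens2_row a c.
Proof.
apply/matrixP => x y; rewrite /tens2_row -rowE [LHS]mxE [RHS]mxE
  [X in _ * X]mxE ord1 /=.
case: (mxtens_indexP y) => b r; rewrite -/(mi b r) tg_tens2.
rewrite (can_eq (@mxtens_indexK _ _)) xpair_eqE [b == _]eq_sym [r == _]eq_sym.
by rewrite mulr_natr; case: andP => [[/eqP -> /eqP ->]|].
Qed.

Lemma thX_tens2_eq0 k : (l < k)%N -> th V ^+ k = 0.
Proof.
move=> lt_lk; apply/matrixP => x y; rewrite [RHS]mxE.
case: (mxtens_indexP x) => b r; case: (mxtens_indexP y) => a c.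
rewrite -!/(mi _ _) th_tens2.
have lt_r : (r < c + k)%N by rewrite (ltn_trans (ltn_ord r)) // ltn_addl.
have lt_r1 : (r.+1 < c + k)%N.
  by rewrite (leq_ltn_trans (ltn_ord r)) // ltn_addl.
by rewrite (ltn_eqF lt_r) (ltn_eqF lt_r1) !mulr0 addr0.
Qed.

(** For l = d both v_1 (x) v_0 and v_0 (x) v_0 generate strings of length d; as h never lowers the
    first tensor index, the functional on v_0 (x) v_(d-1) kills the first string. *)
Lemma taft_tens2_d : l = d -> taft_iso (taft_dsum (M le_ld i') (M le_ld i)) V.
Proof.
move=> l_d; have lt_l1 : (l.-1 < l)%N by rewrite prednK.
pose c0 := Ordinal l_gt0; pose c1 := Ordinal lt_l1.
apply: (@taft_iso_dsum_M _ _ _ _ _ _ _ _ V l l le_ld le_ld i' i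
  (tens2_col ord_max c0) (tens2_col ord0 c0)
  (tens2_row ord_max c1) (tens2_row ord0 c1)) => //.
- by rewrite tg_tens2_col wi' /= addn0 expr1.
- by rewrite l_d th_exp mul0mx.
- exact: tg_tens2_row.
- rewrite tens2_row_col th_tens2 /= mulr0 !mul0r addr0 mul1r add0n.
  by rewrite eqxx.
- by rewrite tg_tens2_col /= addn0 expr0 invr1 mulr1.
- by rewrite l_d th_exp mul0mx.
- exact: tg_tens2_row.
- rewrite tens2_row_col th_tens2 /= mulr0 !mul0r addr0 mul1r add0n.
  by rewrite eqxx.
- move=> k; rewrite tens2_row_col th_tens2 /= mulr0 !mul0r addr0.
  by apply/matrixP => x y; rewrite !mxE mul0rn.
- by rewrite /= mul2n addnn.
Qed.

Hypothesis lt_ld : (l < d)%N.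

Let lt_l1 : (l.-1 < l)%N. Proof. by rewrite prednK. Qed.
Let c0 := Ordinal l_gt0.
Let c1 := Ordinal lt_l1.
Let v1 := tens2_col ord0 c0.
(** The scalar is the inverse of the coefficient of v_1 (x) v_(l-1) in h^l (v_0 (x) v_0), which is
    nonzero as (l)_q is for l < d. *)
Let f1 := (qint q l * (w ^+ i * q ^- l.-1))^-1 *: tens2_row ord_max c1.

Let gv1 : tg V *m v1 = w ^+ i *: v1.
Proof. by rewrite tg_tens2_col /= addn0 expr0 invr1 mulr1. Qed.

Let fg1 : f1 *m tg V = (w ^+ i * q ^- (1 + l.-1)) *: f1.
Proof. by rewrite -scalemxAl tg_tens2_row /= !scalerA mulrC. Qed.

Let fv1 : f1 *m th V ^+ l *m v1 = 1%:M.
Proof.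
rewrite -!scalemxAl tens2_row_col th_tens2 /= mul0r add0r add0n prednK // eqxx.
rewrite !mulr1 scale_scalar_mx mulVf // !mulf_neq0 ?invr_eq0 ?expf_neq0 //.
by rewrite qint_neq0 // l_gt0.
Qed.

Lemma taft_tens2_1 : l = 1%N -> taft_iso (M lt_ld i) V.
Proof.
move=> l1; have h2 : th V ^+ l.+1 = 0 by rewrite thX_tens2_eq0.
have hv1 : th V ^+ l.+1 *m v1 = 0 by rewrite h2 mul0mx.
have [_ QP] := costring_string dvd_dn prim_q prim_w lt_ld (isT : 0 < l.+1)%N gv1 hv1 fg1 fv1.
apply: (@taft_iso_morph _ _ _ _ (M lt_ld i) V (string_mx l.+1 v1)) QP _.
- exact: string_mx_morph.
- by rewrite /= l1.
Qed.

Hypothesis l_gt1 : (1 < l)%N.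

(** Clebsch-Gordan rule: v_0 (x) v_0 generates a string of length l + 1, and a combination of v_0
    (x) v_1 and v_1 (x) v_0 one of length l - 1. *)
Lemma taft_tens2 (le_l1 : (l.-1 <= d)%N) :
  taft_iso (taft_dsum (M lt_ld i) (M le_l1 i')) V.
Proof.
have lt_l2 : (l.-2 < l)%N by lia.
pose c2 := Ordinal lt_l2; pose c3 := Ordinal l_gt1.
pose a j := w ^+ i * q ^- j.
have a_neq0 j : a j != 0 by rewrite mulf_neq0 ?invr_eq0 ?expf_neq0.
(* Both are forced up to scaling by their weights: [v2] by [th V ^+ l.-1 *m v2 = 0],
   and [f2] by vanishing on the string of [v1]. *)
pose v2 := tens2_col ord0 c3 - (qint q l.-1 * a l.-1) *: tens2_col ord_max c0.
pose f2 := qint q l.-1 *: tens2_row ord0 c1 - (a l.-2)^-1 *: tens2_row ord_max c2.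
(* The value of f2 h^(l-2) v2, by which [f2] is divided below. *)
pose y := q^-1 * qint q l.
have y_neq0 : y != 0 by rewrite mulf_neq0 ?invr_eq0 // qint_neq0 // l_gt0.
have lE : l = l.-2.+2 by lia.
have f2E k (x : 'cV_(tdim V)) :
    f2 *m th V ^+ k *m x = qint q l.-1 *: (tens2_row ord0 c1 *m th V ^+ k *m x)
    - (a l.-2)^-1 *: (tens2_row ord_max c2 *m th V ^+ k *m x).
  by rewrite /f2 !mulmxBl -!scalemxAl.
have aS j : a j = q * a j.+1.
  by rewrite /a exprS invfM [w ^+ i * (_ * _)]mulrCA mulVKf.
apply: (@taft_iso_dsum_M _ _ _ _ _ _ _ _ V l.+1 l.-1 lt_ld le_l1 i i' v1 v2
  f1 (y^-1 *: f2) (w ^+ i * q ^- (1 + l.-1)) (w ^+ i * q ^- l.-1)) => //.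
- by rewrite thX_tens2_eq0 // mul0mx.
- by lia.
- rewrite /v2 mulmxBr -scalemxAr !tg_tens2_col /= wi' add0n addn0 expr1.
  by rewrite scalerBr !scalerA; congr (_ - _ *: _); rewrite mulrC.
(* h^(l-1) v2 can only have a component on v_1 (x) v_(l-1), where the two terms of [v2] cancel. *)
- apply/matrixP => x z; rewrite [RHS]mxE ord1 /v2 mulmxBr -scalemxAr -!colE.
  case: (mxtens_indexP x) => b r; rewrite -/(mi b r) !mxE !th_tens2 /=.
  rewrite add1n add0n eqSS -[b == ord_max](inj_eq val_inj) /=.
  rewrite (ltn_eqF (_ : r < l.-1.+1)%N) ?prednK // mulr0 add0r andbF andbT.
  rewrite mulr0 !mul0r addr0; have [->|_] := eqVneq (r : nat) l.-1; last by rewrite !mulr0 subrr.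
  by rewrite /a; ring.
- rewrite -!scalemxAl scalerA mulrC -scalerA; congr (_ *: _).
  rewrite /f2 mulmxBl -!scalemxAl !tg_tens2_row /= add0n add1n.
  by rewrite (_ : l.-1 = l.-2.+1) ?scalerBr ?scalerA; [congr (_ *: _ - _ *: _); ring|lia].
- rewrite -!scalemxAl f2E /v2 !mulmxBr -!scalemxAr !tens2_row_col !th_tens2 /=.
  set t := l.-2 in y_neq0 lE *; rewrite (_ : l.-1 = t.+1); last by rewrite /t; lia.
  apply/matrixP => x z; rewrite !ord1 !mxE !add0n !add1n !eqxx !mulr1n.
  rewrite [t.+1 == t]gtn_eqF // [t.+2 == t]gtn_eqF // ?[t == t.+1]ltn_eqF //.
  rewrite -!/(a _) [a t]aS !(mulr0, mul0r, addr0, add0r, mulr1, mul1r, subr0).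
  rewrite -[RHS](mulVf y_neq0); congr (_ * _).
  rewrite /y lE !qintSr exprS; move: (a_neq0 t.+1) => {aS a_neq0}.
  by move: (a t.+1) (qint q t) (q ^+ t) => a1 b1 b2 a1_neq0; field; apply/andP.
(* Only h^(l-1) v1 meets the support of [f2], and there the two terms of [f2] cancel. *)
- move=> k; rewrite -!scalemxAl f2E !tens2_row_col !th_tens2 /=.
  rewrite !add0n (_ : l.-2.+1 = l.-1) ?mul1r ?mulr0 ?mul0r ?add0r ?addr0; last lia.
  have [<-|_] := eqVneq l.-1 k; last first.
    by apply/matrixP => x z; rewrite !mxE mulr0 !mul0rn !mulr0 subrr mulr0.
  rewrite !mulr1 !scale_scalar_mx [(a _)^-1 * _]mulrCA -/(a _) mulVf //.
  by rewrite subrr scaler0.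
- by rewrite /=; lia.
Qed.

End Fusion.

(** * Relations in the Green ring *)

Section GreenRelations.
Variables (K : fieldType) (n d : nat) (q w : K).
Hypotheses (dvd_dn : (d %| n)%N) (prim_q : d.-primitive_root q).
Hypothesis prim_w : n.-primitive_root w.
Hypotheses (n_gt1 : (1 < n)%N) (d_gt1 : (1 < d)%N).
Hypothesis w_q : w ^+ (n %/ d) = q.
Local Notation M := (taft_M dvd_dn prim_q prim_w).
Local Notation cls := (@green_class K n d q prim_q).

(* [minn l d] makes the class total in [l]; see [green_ME]. *)
Definition green_M l k := cls (M (geq_minr l d) k%:R).

Lemma green_ME l k (le_ld : (l <= d)%N) : green_M l k = cls (M le_ld k%:R).
Proof.
rewrite /green_M; move: (geq_minr l d); rewrite (minn_idPl le_ld) => le_ld'.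
by rewrite (bool_irrelevance le_ld' le_ld).
Qed.

Lemma w_Zp k : w ^+ (k%:R : 'Z_n) = w ^+ k.
Proof. by rewrite val_Zp_nat // (prim_expr_mod prim_w). Qed.

Lemma green_M0 k : green_M 0 k = 0.
Proof. by rewrite (green_ME k (leq0n d)); apply: green_class_dim0. Qed.

Lemma green_M10 : green_M 1 0 = 1.
Proof.
rewrite (green_ME 0 (ltnW d_gt1)) -green_class1.
by apply: green_class_iso; apply: taft_M_one.
Qed.

Lemma green_M_period l k : green_M l (k + n) = green_M l k.
Proof. by rewrite /green_M natrD pchar_Zp ?addr0. Qed.

Lemma green_M1M l j k : (l <= d)%N ->
  green_M 1 j * green_M l k = green_M l (j + k).
Proof.
move=> le_ld; rewrite (green_ME j (ltnW d_gt1)) !(green_ME _ le_ld).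
rewrite -green_classM; apply: green_class_iso; apply: taft_tens_M1.
by rewrite !w_Zp exprD.
Qed.

Local Notation a := (green_M 1 1).
Local Notation x := (green_M 2 0).

Lemma green_M1X k : a ^+ k = green_M 1 k.
Proof.
elim: k => [|k IH]; first by rewrite expr0 green_M10.
by rewrite exprS IH green_M1M ?add1n // ltnW.
Qed.

Lemma green_M1X_n : a ^+ n = 1.
Proof. by rewrite green_M1X (green_M_period 1 0) green_M10. Qed.

Lemma green_MX l k : (l <= d)%N -> green_M l k = a ^+ k * green_M l 0.
Proof. by move=> le_ld; rewrite green_M1X green_M1M // addn0. Qed.

(** The exponent n - n / d stands for -m, which keeps all exponents natural numbers. *)
Let w_inv k : w ^+ ((k + (n - n %/ d))%:R : 'Z_n) = w ^+ (k%:R : 'Z_n) / q.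
Proof.
rewrite !w_Zp exprD; congr (_ * _).
have q_neq0 := prim_root_neq0 prim_q.
apply: (mulIf q_neq0); rewrite mulVf // -[in LHS]w_q -exprD subnK ?leq_div //.
exact: prim_expr_order.
Qed.

Lemma green_M2M l k : (0 < l < d)%N ->
  x * green_M l k = green_M l.+1 k + green_M l.-1 (k + (n - n %/ d)).
Proof.
case/andP=> l_gt0 lt_ld; have le_ld := ltnW lt_ld.
have le_l1 : (l.-1 <= d)%N := leq_trans (leq_pred l) le_ld.
rewrite (green_ME 0 d_gt1) (green_ME k le_ld) (green_ME k lt_ld).
rewrite -green_classM (green_ME _ le_l1).
have [l_le1|l_gt1] := leqP l 1.
  have l1 : l = 1%N by apply/eqP; rewrite eqn_leq l_le1.
  rewrite [X in _ + X]green_class_dim0 /= ?l1 // addr0; apply/esym.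
  exact/green_class_iso/taft_tens2_1.
rewrite -green_class_dsum; apply/esym/green_class_iso.
exact: taft_tens2 (w_inv k) lt_ld l_gt1 le_l1.
Qed.

Lemma green_M2M_d k :
  x * green_M d k = green_M d (k + (n - n %/ d)) + green_M d k.
Proof.
rewrite (green_ME 0 d_gt1) !(green_ME _ (leqnn d)) -green_classM.
rewrite -green_class_dsum; apply/esym/green_class_iso.
by apply: taft_tens2_d (ltnW d_gt1) (w_inv k) _.
Qed.

Lemma green_M2C : x * a = a * x.
Proof.
rewrite green_M1M // green_M2M //.
by rewrite green_M0 addr0.
Qed.

Hypothesis n_neq0 : n%:R != 0 :> K.

Lemma green_M_span (P : green_ring n prim_q -> Prop) :
  (forall y z, P y -> P z -> P (y - z)) ->
  (forall l k, (0 < l <= d)%N -> P (a ^+ k * green_M l 0)) -> forall y, P y.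
Proof.
move=> PB PM; apply: (@green_span _ _ _ _ _ dvd_dn prim_q prim_w n_gt1 n_neq0 P PB).
move=> l le_ld i l_gt0.
have -> : i = (i : nat)%:R :> 'Z_n by rewrite natr_Zp.
by rewrite -green_ME green_MX //; apply: PM; rewrite l_gt0.
Qed.

End GreenRelations.

(** * The Jacobson radical of a commutative ring *)

Section JacobsonRadical.
Variable R : pzRingType.
Implicit Types (I L : set R) (y z u : R).

Lemma left_ideal_bigcup (F : set (set R)) I0 :
  F I0 -> (forall I, F I -> left_ideal I) -> total_on F subset ->
  left_ideal (\bigcup_(I in F) I)%classic.
Proof.
move=> FI0 Fideal Ftot; split.
- by exists I0 => //; have [] := Fideal _ FI0.
- move=> y z [I FI Iy] [L FL Lz].
  case: (Ftot _ _ FI FL) => sub.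
    by exists L => //; have [_ LD _] := Fideal _ FL; apply: LD => //; apply: sub.
  by exists I => //; have [_ ID _] := Fideal _ FI; apply: ID => //; apply: sub.
- by move=> c y [I FI Iy]; exists I => //; have [_ _ IM] := Fideal _ FI; apply: IM.
Qed.

Lemma left_idealT I : left_ideal I -> I 1 -> I = setT.
Proof.
move=> [_ _ IM] I1; apply/seteqP; split=> // y _.
by rewrite -[y]mulr1; apply: IM.
Qed.

Lemma maximal_left_ideal_ex I : left_ideal I -> ~ I 1 ->
  exists L, maximal_left_ideal L /\ (I `<=` L)%classic.
Proof.
move=> Iideal I1.
pose P : set (set R) := fun L => L = set0 \/ [/\ left_ideal L, ~ L 1 & (I `<=` L)%classic].
have [F FP Ftot|L [PL Lmax]] := @Zorn_bigcup R P.
  have [[I0 [FI0 I0ne]]|F0] := pselect (exists I0, F I0 /\ I0 <> set0); last first.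
    left; apply/seteqP; split=> // y [L FL Ly]; have [L0|Lne] := pselect (L = set0).
      by rewrite L0 in Ly.
    by case: F0; exists L.
  right; pose F' : set (set R) := fun L => F L /\ L <> set0.
  have F'P L : F' L -> [/\ left_ideal L, ~ L 1 & (I `<=` L)%classic].
    by case=> FL Lne; case: (FP _ FL) => // L0; case: Lne.
  have -> : (\bigcup_(L in F) L)%classic = (\bigcup_(L in F') L)%classic.
    apply/seteqP; split=> y [L FL Ly]; exists L => //; last by case: FL.
    by split=> // L0; rewrite L0 in Ly.
  split.
  - apply: (@left_ideal_bigcup F' I0); [by split|by move=> L /F'P[]|].
    by move=> L1 L2 [FL1 _] [FL2 _]; apply: Ftot.
  - by move=> [L /F'P[_ L1 _]].
  - by move=> y Iy; exists I0 => //; have [//|_ _ II0] := F'P I0; apply: II0.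
have LE : [/\ left_ideal L, ~ L 1 & (I `<=` L)%classic].
  case: PL => // L0; exfalso; apply: (Lmax I); last by right; split.
  rewrite L0; split; first by [].
  by move=> /(_ 0); case: Iideal => I0 _ _ /(_ I0).
case: LE => Lideal L1 IL; exists L; split=> //; split=> //.
  by move=> LT; apply: L1; rewrite LT.
move=> L' L'ideal LL'; have [L'1|L'1] := pselect (L' 1).
  by right; apply: left_idealT.
left; apply/seteqP; split=> //; apply: contrapT => nL'L.
apply: (Lmax L'); first by split.
by right; split=> // y Iy; apply/LL'/IL.
Qed.

(** Otherwise the left ideal R (1 - z y) lies in a maximal one, which also contains z y and hence
    1. *)
Lemma jacobson_radical_unit y z :
  jacobson_radical R y -> exists u, u * (1 - z * y) = 1.
Proof.
move=> Jy; pose I : set R := fun t => exists u, t = u * (1 - z * y).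
have [[u uE]|I1] := pselect (I 1); first by exists u.
have Iideal : left_ideal I.
  split; first by exists 0; rewrite mul0r.
    by move=> _ _ [u ->] [v ->]; exists (u + v); rewrite mulrDl.
  by move=> c _ [u ->]; exists (c * u); rewrite mulrA.
have [L [Lmax IL]] := maximal_left_ideal_ex Iideal I1.
have Ly := Jy L Lmax; case: Lmax => Lideal LT _; case: LT.
apply: left_idealT => //; case: Lideal => _ LD LM.
rewrite -[1](subrK (z * y)); apply: LD; last exact: LM.
by apply: IL; exists 1; rewrite mul1r.
Qed.

Hypothesis mulC : forall y z, y * z = z * y.

(** For a maximal L, either L + R y = L, or 1 = u + v y with u in L, and multiplying by y gives y =
    y u. *)
Lemma jacobson_radical_sqr0 y : y * y = 0 -> jacobson_radical R y.
Proof.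
move=> yy L [[L0 LD LM] LT Lmax].
pose L' : set R := fun t => exists u v, L u /\ t = u + v * y.
have L'ideal : left_ideal L'.
  split; first by exists 0, 0; rewrite mul0r addr0.
    move=> _ _ [u [v [Lu ->]]] [u' [v' [Lu' ->]]].
    by exists (u + u'), (v + v'); rewrite mulrDl addrACA; split=> //; apply: LD.
  move=> c _ [u [v [Lu ->]]]; exists (c * u), (c * v).
  by rewrite mulrDr mulrA; split=> //; apply: LM.
have [t Lt|eL|eT] := Lmax L' L'ideal.
- by exists t, 0; rewrite mul0r addr0.
- by rewrite -eL; exists 0, 1; rewrite add0r mul1r.
have : L' 1 by rewrite eT.
case=> u [v [Lu e1]]; rewrite -[y]mulr1 e1 mulrDr [v * y]mulC mulrA yy mul0r.
by rewrite addr0; apply: LM.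
Qed.

Lemma jacobson_radical_ideal : two_sided_ideal (@jacobson_radical R).
Proof.
have Jl : left_ideal (@jacobson_radical R).
  split.
  - by move=> L [[L0 _ _] _ _].
  - move=> y z Jy Jz L Lmax; have [[_ LD _] _ _] := Lmax.
    by apply: LD; [apply: Jy|apply: Jz].
  - by move=> c y Jy L Lmax; have [[_ _ LM] _ _] := Lmax; apply: LM; apply: Jy.
by split=> // c y Jy; rewrite mulC; case: Jl => _ _; apply.
Qed.

Lemma principal_ideal_sub y I :
  two_sided_ideal I -> I y -> (principal_ideal y `<=` I)%classic.
Proof. by move=> Iideal Iy z; apply; split=> // _ ->. Qed.

Lemma principal_ideal_ideal y : two_sided_ideal (principal_ideal y).
Proof.
split; first split.
- by move=> I [[[I0 _ _] _] _].
- move=> u v Iu Iv I Iideal; have [[[_ ID _] _] _] := Iideal.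
  exact: ID (Iu _ Iideal) (Iv _ Iideal).
- by move=> c u Iu I Iideal; have [[[_ _ IM] _] _] := Iideal; apply/IM/(Iu _ Iideal).
- by move=> c u Iu I Iideal; have [[_ IM] _] := Iideal; apply/IM/(Iu _ Iideal).
Qed.

Lemma principal_ideal_gen y : principal_ideal y y.
Proof. by move=> I [_]; apply. Qed.

End JacobsonRadical.

(** * Morphisms from rings finite over the integers *)

Section IntegralValues.
Variables (R : pzRingType) (K : fieldType) (f : R -> K).
Hypothesis intrK_eq0 : forall c : int, c%:~R = 0 :> K -> c = 0.
Hypothesis fB : forall y z, f (y - z) = f y - f z.
Hypothesis f1 : f 1 = 1.
Hypothesis fM : forall y z, f (y * z) = f y * f z.

Let f0 : f 0 = 0. Proof. by rewrite -(subrr 0) fB subrr. Qed.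
Let fN y : f (- y) = - f y. Proof. by rewrite -sub0r fB f0 sub0r. Qed.
Let fD y z : f (y + z) = f y + f z.
Proof. by rewrite -[z in LHS]opprK fB fN opprK. Qed.

Lemma morph_sum (I : finType) (F : I -> R) : f (\sum_i F i) = \sum_i f (F i).
Proof. exact: (big_morph f fD f0). Qed.

Lemma morph_mulz y (c : int) : f (y *~ c) = f y *~ c.
Proof.
have fMn k : f (y *+ k) = f y *+ k.
  by elim: k => [|k IH]; [rewrite !mulr0n f0|rewrite !mulrS fD IH].
by case: c => k; rewrite ?NegzE ?mulrNz -!pmulrn ?fN fMn.
Qed.

Local Notation intp p := (map_poly (intr : int -> K) p).

(** Determinant trick: multiplication by [y] on the generators has an integer matrix, and the values
    [f (g j)] form an eigenvector for [f y]; it is nonzero since 1 is a combination of the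
    generators. *)
Lemma finite_span_integral N (g : 'I_N -> R) :
  (forall y, exists c : 'I_N -> int, y = \sum_i g i *~ c i) ->
  forall y, exists p : {poly int}, p \is monic /\ root (intp p) (f y).
Proof.
move=> span y.
have /fin_all_exists[A AE] : forall i : 'I_N, exists c : 'I_N -> int,
    y * g i = \sum_j g j *~ c j by move=> i; apply: span.
pose B : 'M[int]_N := \matrix_(j, i) A i j.
exists (char_poly B); split; first exact: char_poly_monic.
rewrite map_char_poly -eigenvalue_root_char; apply/eigenvalueP.
exists (\row_j f (g j)).
  apply/rowP => i; rewrite !mxE -fM AE morph_sum; apply: eq_bigr => j _.
  by rewrite !mxE morph_mulz mulrzr.
apply/eqP => /rowP g0; have [c e1] := span 1.
move: f1; rewrite e1 morph_sum big1 => [/eqP|i _]; first by rewrite eq_sym oner_eq0.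
by rewrite morph_mulz; have := g0 i; rewrite !mxE => ->; rewrite mul0rz.
Qed.

(** Realizes an integer polynomial in [f y], such as the cofactor from [integral_dvd_const], by a
    ring element. *)
Lemma horner_lift y (p : {poly int}) : exists z, f z = (intp p).[f y].
Proof.
elim/poly_ind: p => [|p c [z fz]]; first by exists 0; rewrite rmorph0 horner0.
exists (z * y + 1 *~ c).
by rewrite rmorphD rmorphM /= map_polyX map_polyC hornerMXaddC fD fM fz morph_mulz f1.
Qed.

(** As t is nonzero, factors X can be stripped from p until its constant term c is nonzero; then p =
    s X + c gives - s(t) t = c. *)
Lemma integral_dvd_const (t : K) (p : {poly int}) :
  t != 0 -> p != 0 -> root (intp p) t ->
  exists (r : {poly int}) (c : int), c != 0 /\ (intp r).[t] * t = c%:~R.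
Proof.
move=> t_neq0; elim/poly_ind: p => [|p c IH]; first by rewrite eqxx.
rewrite rmorphD rmorphM /= map_polyX map_polyC /root hornerMXaddC => pc_neq0 pc0.
have [c0|c_neq0] := eqVneq c 0.
  move: pc0 pc_neq0; rewrite c0 addr0 addr0 mulf_eq0 (negPf t_neq0) orbF.
  rewrite mulf_eq0 negb_or => p0 /andP[p_neq0 _]; exact: IH.
exists (- p), c; split=> //; rewrite rmorphN hornerN mulNr.
by apply/eqP; rewrite eq_sym -addr_eq0 addrC.
Qed.

(** Rational root argument: multiplying the monic equation of t = 1/N by N^s, with s its degree,
    leaves 1 plus a multiple of N. *)
Lemma integral_inv_int (t : K) (p : {poly int}) (N : int) :
  p \is monic -> root (intp p) t -> t * N%:~R = 1 -> exists c, N * c = 1.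
Proof.
move=> p_monic p0 tN.
pose s := (size p).-1.
have sE : size p = s.+1 by rewrite prednK // lt0n size_poly_eq0 monic_neq0.
pose e : int := \sum_(i < s) p`_i * N ^+ (s - i.+1).
exists (- e); apply/eqP; rewrite mulrN -subr_eq0 -opprD oppr_eq0; apply/eqP.
apply: intrK_eq0; have tX j : t ^+ j * N%:~R ^+ j = 1 by rewrite -exprMn tN expr1n.
have /eqP : (intp p).[t] * N%:~R ^+ s = 0 by rewrite (rootP p0) mul0r.
rewrite horner_coef size_map_poly_id0; last first.
  by rewrite (monicP p_monic) oner_neq0.
rewrite sE big_ord_recr /= coef_map -lead_coefE (monicP p_monic) mul1r.
rewrite mulrDl tX => /eqP <-; rewrite rmorphD rmorph1 /=; congr (_ + _).
rewrite rmorphM rmorph_sum mulr_suml mulr_sumr; apply: eq_bigr => i _.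
have -> : N%:~R ^+ s = N%:~R ^+ i * (N%:~R * N%:~R ^+ (s - i.+1)) :> K.
  by rewrite -exprS -exprD; congr (_ ^+ _); have := ltn_ord i; lia.
rewrite coef_map rmorphM rmorphXn /=.
by rewrite -mulrA (mulrA (t ^+ i)) tX mul1r mulrCA.
Qed.

Lemma jacobson_radical_morph0 N (g : 'I_N -> R) y :
  (forall z, exists c : 'I_N -> int, z = \sum_i g i *~ c i) ->
  jacobson_radical R y -> f y = 0.
Proof.
move=> /finite_span_integral integral Jy; apply/eqP; apply: contraT => fy_neq0.
have [p [p_monic p0]] := integral y.
have [r [c [c_neq0 rc]]] := integral_dvd_const fy_neq0 (monic_neq0 p_monic) p0.
have [z fz] := horner_lift y r.
have [u uE] := jacobson_radical_unit (z *~ - c) Jy.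
have [p' [p'_monic p'0]] := integral u.
(* [- c * z * y] lies in the radical and has value [- c ^+ 2]. *)
have fu : f u * (1 + c * c)%:~R = 1.
  rewrite -[RHS]f1 -uE fM fB fM morph_mulz f1 fz; congr (_ * _).
  rewrite intrD intrM mulr1z mulrNz -[_.[_] *~ c]mulrzr mulNr opprK mulrAC rc.
  by [].
have [c' cc'] := integral_inv_int p'_monic p'0 fu.
(* The integer 1 + c^2 would be a unit although it is at least 2. *)
have cc_gt0 : (0 < c * c)%R by move/eqP: c_neq0 => c_neq0; nia.
have [c'_le0|c'_ge1] : (c' <= 0)%R \/ (1 <= c')%R by lia.
  by nia.
by nia.
Qed.

End IntegralValues.

(** * Chebyshev polynomials *)

Section Chebyshev.
Variables (S : pzRingType) (b z : S).

(* With [b] and [z] the classes of M(1,-m) and M(2,0), [cheb b z l] is the class of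
   M(l,0) for [l <= d]. *)
Fixpoint cheb l : S :=
  match l with
  | 0%N => 0
  | 1%N => 1
  | l''.+1 as l' => z * cheb l'' - b * cheb l''.-1
  end.

Lemma chebSS l : cheb l.+2 = z * cheb l.+1 - b * cheb l.
Proof. by []. Qed.

End Chebyshev.

Arguments cheb : simpl never.

Lemma intr_eq0_char0 (K : fieldType) : [pchar K] =i pred0 ->
  forall c : int, c%:~R = 0 :> K -> c = 0.
Proof.
move=> /pcharf0P char0 [k|k] /eqP; rewrite ?NegzE ?mulrNz ?oppr_eq0 -pmulrn char0 //.
by move=> /eqP ->.
Qed.

Section ChebyshevRoots.
Variable K : fieldType.
Implicit Types (b z : K).

Lemma unity_root_inj N (u : K) (c : 'I_N -> K) : N.-primitive_root u ->
  (forall z, z ^+ N = 1 -> \sum_(k < N) c k * z ^+ k = 0) -> forall k, c k = 0.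
Proof.
move=> prim_u c0 k; pose p := rVpoly (\row_k c k).
have cE (j : 'I_N) : p`_j = c j by rewrite coef_rVpoly_ord mxE.
have size_p : (size p <= N)%N := size_poly _ _.
suff p0 : p = 0 by rewrite -cE p0 coef0.
apply/eqP; apply: contraT => p_neq0.
suff : (size [seq u ^+ j | j <- iota 0 N] < size p)%N.
  by rewrite size_map size_iota ltnNge size_p.
apply: max_poly_roots => //.
  apply/allP => _ /mapP[j _ ->]; rewrite /root (horner_coef_wide _ size_p).
  apply/eqP; rewrite -[RHS](c0 (u ^+ j)).
    by apply: eq_bigr => i _; rewrite cE.
  by rewrite exprAC (prim_expr_order prim_u) expr1n.
rewrite map_inj_in_uniq ?iota_uniq // => i j; rewrite !mem_iota !add0n => lt_i lt_j.
by move=> /eqP; rewrite (eq_prim_root_expr prim_u) !modn_small // => /eqP.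
Qed.

Lemma horner_cheb b z l : (cheb b%:P 'X l).[z] = cheb b z l.
Proof.
have [j] := ubnP l; elim: j l => // j IH [|[|l]] lt_lj.
- by rewrite horner0.
- by rewrite hornerC.
by rewrite !chebSS !hornerE !IH //; apply: ltnW.
Qed.

(** Used at the extra point z = 1 + b with b = 1, where it makes U_d nonzero in characteristic 0. *)
Lemma cheb12 l : cheb 1 2 l = l%:R :> K.
Proof.
have [j] := ubnP l; elim: j l => // j IH [|[|l]] lt_lj //.
by rewrite chebSS !IH //; [rewrite -!natr1; ring|lia].
Qed.

Lemma size_cheb b l : size (cheb b%:P 'X l) = l.
Proof.
have [j] := ubnP l; elim: j l => // j IH [|[|l]] lt_lj.
- exact: size_poly0.
- exact: size_poly1.
have sz1 : size (cheb b%:P 'X l.+1) = l.+1 by apply: IH; lia.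
have sz : size ('X * cheb b%:P 'X l.+1) = l.+2.
  by rewrite mulrC size_mulX ?sz1 // -size_poly_eq0 sz1.
rewrite chebSS size_polyDl sz // size_polyN.
rewrite mul_polyC; apply: leq_ltn_trans (size_scale_leq _ _) _.
by rewrite IH //; lia.
Qed.

(** U_(l+1) has degree l, so the largest index with a nonzero coefficient would give a leading term
    that nothing cancels. *)
Lemma cheb_free b N (c : 'I_N -> K) :
  \sum_l c l *: cheb b%:P 'X l.+1 = 0 -> forall l, c l = 0.
Proof.
move=> c0 l0; apply/eqP; apply: contraT => c_neq0.
case: (@arg_maxnP _ l0 (fun l => c l != 0) (fun l => l)) => // l cl_neq0 lmax.
move/polyP/(_ l): c0; rewrite coef0 coef_sum (bigD1 l) //= big1 => [|j ne_jl].
  rewrite addr0 coefZ => /eqP; rewrite mulf_eq0 (negPf cl_neq0) /=.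
  have -> : (cheb b%:P 'X l.+1)`_l = lead_coef (cheb b%:P 'X l.+1).
    by rewrite lead_coefE size_cheb.
  by rewrite lead_coef_eq0 -size_poly_eq0 size_cheb.
rewrite coefZ; case: (ltngtP j l) => [lt_jl|lt_lj|e_jl].
- by rewrite nth_default ?mulr0 // size_cheb.
- have [->|cj_neq0] := eqVneq (c j) 0; first by rewrite mul0r.
  by have /= := lmax j cj_neq0; rewrite leqNgt lt_lj.
by rewrite (val_inj e_jl) eqxx in ne_jl.
Qed.

(** Binet's formula for the roots s e and s / e of X^2 - z X + b, with denominators cleared so that
    e = e^-1 is allowed. *)
Lemma chebE (s e : K) l : e != 0 ->
  cheb (s ^+ 2) (s * (e + e^-1)) l * (s * (e - e^-1)) =
  s ^+ l * (e ^+ l - e ^- l).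
Proof.
move=> e_neq0; have [j] := ubnP l; elim: j l => // j IH [|[|l]] lt_lj.
- by rewrite mul0r !expr0 invr1 subrr mulr0.
- by rewrite mul1r !expr1.
rewrite chebSS mulrBl -[s * _ * _ * _]mulrA IH; last by lia.
rewrite -[s ^+ 2 * _ * _]mulrA IH; last by lia.
rewrite (exprS s l.+1) (exprS e l.+1) !(exprS s l) !(exprS e l).
by field; rewrite expf_neq0.
Qed.

End ChebyshevRoots.

(** * Roots of U_d from roots of unity *)

Section RootsOfUnity.
Variables (K : closedFieldType) (d : nat) (q : K).
Hypotheses (d_gt1 : (1 < d)%N) (prim_q : d.-primitive_root q).
Hypothesis two_neq0 : 2 != 0 :> K.

Lemma sqrt_ex (b : K) : exists s, s ^+ 2 = b.
Proof.
have /closed_rootP[s] : size ('X^2 - b%:P) != 1.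
  by rewrite size_XnsubC.
by rewrite /root !hornerE subr_eq0 => /eqP <-; exists s; rewrite expr2.
Qed.

(** A square root e of q has e^d = 1 or -1; in the first case d is odd, and -e has the required
    sign. *)
Lemma sqrt_prim_root : exists e : K, e ^+ 2 = q /\ e ^+ d = -1.
Proof.
have [e e2] := sqrt_ex q.
have : (e ^+ d - 1) * (e ^+ d + 1) = 0.
  by rewrite -subr_sqr expr1n -exprM mulnC exprM e2 (prim_expr_order prim_q) subrr.
move/eqP; rewrite mulf_eq0 subr_eq0 addr_eq0 => /orP[] /eqP ed; last by exists e.
(* For even d, e^d = 1 would read q^(d/2) = 1, against the order of q. *)
have odd_d : odd d.
  apply: contraT => even_d; have := prim_order_dvd prim_q d./2.
  rewrite -e2 -exprM mulnC muln2 even_halfK // ed eqxx => /dvdn_leq.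
  by move: d_gt1; lia.
exists (- e); split; first by rewrite sqrrN.
by rewrite exprNn -signr_odd odd_d ed expr1 mulr1.
Qed.

(** The roots are s (e^k + e^-k) for 0 < k < d: in [chebE] the right-hand side vanishes because
    e^(2kd) = 1, while e^k - e^-k does not because e^(2k) = q^k is not 1. *)
Lemma cheb_roots (b : K) : b != 0 ->
  exists rs, [/\ uniq rs, size rs = d.-1 & forall z, z \in rs -> cheb b z d = 0].
Proof.
move=> b_neq0; have [s s2] := sqrt_ex b; have [e [e2 ed]] := sqrt_prim_root.
have s_neq0 : s != 0 by rewrite -sqrf_eq0 s2.
have e_neq0 : e != 0 by rewrite -sqrf_eq0 e2 (prim_root_neq0 prim_q).
have eX_neq1 k : (0 < k < d)%N -> (e ^+ k) ^+ 2 != 1.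
  case/andP=> k_gt0 lt_kd; rewrite exprAC e2 -(prim_order_dvd prim_q).
  by apply/negP => /(dvdn_leq k_gt0); rewrite leqNgt lt_kd.
pose z k := s * (e ^+ k + (e ^+ k)^-1).
exists [seq z k | k <- iota 1 d.-1]; split; last 1 first.
- move=> y /mapP[k]; rewrite mem_iota add1n (prednK (ltnW d_gt1)) => lt_k ->.
  have ek_neq0 : e ^+ k != 0 by rewrite expf_neq0.
  have ekd : (e ^+ k) ^- d = (e ^+ k) ^+ d.
    by rewrite exprAC ed -exprVn invrN1.
  have := chebE s d ek_neq0; rewrite -/(z k) s2 ekd subrr mulr0 => /eqP.
  rewrite mulf_eq0 => /orP[/eqP //|].
  rewrite mulf_eq0 (negPf s_neq0) /= subr_eq0 => /eqP eV.
  by have := eX_neq1 k lt_k; rewrite expr2 {1}eV mulVf // eqxx.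
- rewrite map_inj_in_uniq ?iota_uniq // => j k; rewrite !mem_iota add1n (prednK (ltnW d_gt1)).
  move=> lt_j lt_k; rewrite /z => /(mulfI s_neq0) ejk.
  have ek_neq0 i : e ^+ i != 0 by rewrite expf_neq0.
  (* Equal values force e^j = e^k or e^(j+k) = 1. *)
  have : (e ^+ j - e ^+ k) * (1 - (e ^+ (j + k))^-1) = 0.
    rewrite exprD.
    have -> : (e ^+ j - e ^+ k) * (1 - (e ^+ j * e ^+ k)^-1) =
       (e ^+ j + (e ^+ j)^-1) - (e ^+ k + (e ^+ k)^-1).
      by field; rewrite !ek_neq0.
    by rewrite ejk subrr.
  move/eqP; rewrite mulf_eq0 !subr_eq0 => /orP[/eqP eE|].
    apply/eqP; have : q ^+ j == q ^+ k by rewrite -e2 exprAC eE exprAC.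
    rewrite (eq_prim_root_expr prim_q) !modn_small //; by [case/andP: lt_k|case/andP: lt_j].
  rewrite eq_sym invr_eq1 => /eqP ejk1; exfalso.
  have : (d %| j + k)%N.
    by rewrite (prim_order_dvd prim_q) -e2 exprAC ejk1 expr1n.
  (* Here 0 < j + k < 2d, so j + k = d, where e^d = -1 is not 1. *)
  case/dvdnP=> t jkE; have t1 : t = 1%N by move: lt_j lt_k jkE; clear; nia.
  move: ejk1; rewrite jkE t1 mul1n ed => /eqP.
  by rewrite eq_sym -addr_eq0 (negPf two_neq0).
by rewrite size_map size_iota.
Qed.

Variables (n e m : nat) (w : K).
Hypotheses (char0 : [pchar K] =i pred0) (prim_w : n.-primitive_root w).
Hypotheses (emn : (e + m = n)%N) (mdn : (m * d = n)%N).

Lemma cheb_coef0 (c : 'I_n -> 'I_d -> int) (l0 : 'I_d) : l0 = d.-1 :> nat ->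
  (forall zeta z : K, zeta ^+ n = 1 ->
    (z - 1 - zeta ^+ e) * cheb (zeta ^+ e) z d = 0 ->
    \sum_(k < n) \sum_(l < d) (zeta ^+ k * cheb (zeta ^+ e) z l.+1) *~ c k l = 0) ->
  (forall k (l : 'I_d), (l.+1 < d)%N -> c k l = 0) /\
  (forall zeta : K, zeta ^+ m = 1 -> \sum_(k < n) zeta ^+ k *~ c k l0 = 0).
Proof.
move=> l0E cE.
pose C (zeta : K) (l : 'I_d) := \sum_(k < n) zeta ^+ k *~ c k l.
have {}cE (zeta z : K) : zeta ^+ n = 1 ->
    (z - 1 - zeta ^+ e) * cheb (zeta ^+ e) z d = 0 ->
    \sum_(l < d) C zeta l * cheb (zeta ^+ e) z l.+1 = 0.
  move=> zn zU; rewrite -[RHS](cE zeta z zn zU) exchange_big; apply: eq_bigr => l _.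
  by rewrite mulr_suml; apply: eq_bigr => k _; rewrite -mulrzAl.
have c0 : forall k (l : 'I_d), (l.+1 < d)%N -> c k l = 0.
  move=> k l lt_ld; apply: (intr_eq0_char0 char0).
  apply: (unity_root_inj (c := fun k => (c k l)%:~R) prim_w) => zeta zn.
  transitivity (C zeta l).
    by apply: eq_bigr => j _; rewrite mulrC mulrzr.
  have z_neq0 : zeta ^+ e != 0.
    rewrite expf_neq0 //; apply/eqP => z0; move/eqP: zn.
    by rewrite z0 expr0n gtn_eqF ?(prim_order_gt0 prim_w) // eq_sym oner_eq0.
  have [rs [rs_uniq rs_size rsE]] := cheb_roots z_neq0.
  (* The term of U_d is dropped, since U_d vanishes at the chosen points; what is left has degree at
     most d - 2 and d - 1 roots. *)
  pose C' (j : 'I_d) := if (j.+1 < d)%N then C zeta j else 0.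
  suff C'0 : \sum_j C' j *: cheb (zeta ^+ e)%:P 'X j.+1 = 0.
    by have := cheb_free C'0 l; rewrite /C' lt_ld.
  set p := (LHS); apply/eqP; apply: contraT => p_neq0.
  have : (size rs < size p)%N.
    apply: max_poly_roots => //; apply/allP => z /rsE z0; apply/eqP.
    rewrite -[RHS](cE zeta z) // ?z0 ?mulr0 // horner_sum; apply: eq_bigr => j _.
    rewrite hornerZ horner_cheb /C'; case: ltnP => // le_dj.
    have -> : j.+1 = d by apply/eqP; rewrite eqn_leq le_dj ltn_ord.
    by rewrite z0 !mulr0.
  rewrite ltnNge rs_size (leq_trans (size_sum _ _ _)) //.
  apply/bigmax_leqP => j _; rewrite /C'; case: ifP => [lt_jd|_].
    by rewrite (leq_trans (size_scale_leq _ _)) // size_cheb; lia.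
  by rewrite scale0r size_poly0.
split=> // zeta zm.
have zn : zeta ^+ n = 1 by rewrite -mdn exprM zm expr1n.
have ze : zeta ^+ e = 1.
  have -> : e = (m * d.-1)%N by nia.
  by rewrite exprM zm expr1n.
(* With zeta^e = 1, the value z = 2 annihilates the linear factor z - 1 - zeta^e. *)
have := cE zeta 2 zn; rewrite ze (_ : 2 - 1 - 1 = 0); last by ring.
rewrite mul0r (bigD1 l0) //= big1 => [|l ne_l]; last first.
  rewrite /C big1 ?mul0r // => k _; rewrite c0 ?mulr0z //.
  by have := ltn_ord l; move: ne_l; rewrite -(inj_eq val_inj) /= l0E; lia.
rewrite addr0 l0E prednK 1?ltnW // cheb12 => /(_ erefl) /eqP.
rewrite mulf_eq0 => /orP[/eqP //|].
by move/pcharf0P: char0 => ->; rewrite gtn_eqF // ltnW.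
Qed.

End RootsOfUnity.

(** * Rank invariants *)

Section RankInvariants.
Variables (K : fieldType) (n d : nat) (q w : K).
Local Notation taft_mod := (taft_mod n d q).
Implicit Types (U V W : taft_mod).

(** The rank of h^j on the w^k-weight space: additive and isomorphism-invariant, so it yields
    functions on the Green ring. *)
Definition weight_rank V j k := \rank (th V ^+ j *m weight_proj w V k).

Lemma weight_rank_iso V W j k : taft_iso V W -> weight_rank V j k = weight_rank W j k.
Proof.
case=> P [Q [QP PQ Pg Ph]].
have PX (A : 'M_(tdim V)) (B : 'M_(tdim W)) i :
    P *m A = B *m P -> P *m A ^+ i = B ^+ i *m P.
  move=> PA; elim: i => [|i IH]; first by rewrite mulmx1 mul1mx.
  by rewrite !exprSr -[A ^+ i * A]/(_ *m _) -[B ^+ i * B]/(_ *m _) mulmxA IH -!mulmxA PA.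
have PE : P *m weight_proj w V k = weight_proj w W k *m P.
  rewrite /weight_proj -scalemxAr -scalemxAl mulmx_sumr mulmx_suml; congr (_ *: _).
  by apply: eq_bigr => i _; rewrite -scalemxAr -scalemxAl (PX _ _ _ Pg).
have PA : P *m (th V ^+ j *m weight_proj w V k) =
    (th W ^+ j *m weight_proj w W k) *m P.
  by rewrite mulmxA (PX _ _ _ Ph) -mulmxA PE mulmxA.
apply/eqP; rewrite eqn_leq /weight_rank; apply/andP; split.
  rewrite -[X in (\rank X <= _)%N]mul1mx -QP -mulmxA PA.
  by rewrite (leq_trans (mxrankM_maxr _ _)) // mxrankM_maxl.
rewrite -[X in (\rank X <= _)%N]mulmx1 -PQ mulmxA -PA.
by rewrite (leq_trans (mxrankM_maxl _ _)) // mxrankM_maxr.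
Qed.

Lemma weight_rank_dsum V W j k :
  weight_rank (taft_dsum V W) j k = (weight_rank V j k + weight_rank W j k)%N.
Proof.
rewrite /weight_rank /= block_diag_exp.
have -> : weight_proj w (taft_dsum V W) k =
    block_mx (weight_proj w V k) 0 0 (weight_proj w W k).
  rewrite /weight_proj /=.
  have sumE N : \sum_(i < N) w ^- (k * i) *: block_mx (tg V) 0 0 (tg W) ^+ i =
      block_mx (\sum_(i < N) w ^- (k * i) *: tg V ^+ i) 0 0
        (\sum_(i < N) w ^- (k * i) *: tg W ^+ i).
    elim: N => [|N IH]; first by rewrite !big_ord0 block_mx_const.
    rewrite !big_ord_recr /= IH block_diag_exp scale_block_mx add_block_mx.
    by rewrite !scaler0 !addr0.
  by rewrite sumE scale_block_mx !scaler0.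
by rewrite mulmx_block !(mulmx0, mul0mx, addr0, add0r) rank_diag_block_mx.
Qed.

Hypotheses (dvd_dn : (d %| n)%N) (prim_q : d.-primitive_root q).
Hypothesis prim_w : n.-primitive_root w.
Hypothesis n_neq0 : n%:R != 0 :> K.
Local Notation M := (taft_M dvd_dn prim_q prim_w).

(** The weights of v_0, ..., v_(l-1) are distinct, so the matrix is zero or the single unit taking
    v_c to v_(c+j), which requires c < l - j. *)
Lemma weight_rank_M l (le_ld : (l <= d)%N) i j k :
  weight_rank (M le_ld i) j k =
  (\sum_(c < l - j) (w ^+ i * q ^- c == w ^+ k)%R)%N.
Proof.
have q_neq0 := prim_root_neq0 prim_q; have w_neq0 := prim_root_neq0 prim_w.
rewrite /weight_rank; set A := th (M le_ld i) ^+ j *m weight_proj w (M le_ld i) k.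
have AE r c : A r c = ((w ^+ i * q ^- c == w ^+ k) && (r == c + j :> nat)%N)%:R.
  have -> : A r c = (A *m delta_mx c (0 : 'I_1)) r 0 by rewrite -colE [RHS]mxE.
  rewrite -mulmxA (weight_proj_eigen prim_w n_neq0 k (a := w ^+ i * q ^- c)).
  - rewrite -scalemxAr -colE mxE [X in _ * X]mxE matrix_shift_exp mxE.
    by rewrite -natrM mulnb.
  - rewrite exprMn exprVn exprAC (prim_expr_order prim_w) expr1n mul1r exprAC.
    by rewrite (eqP (_ : q ^+ n == 1)) ?expr1n ?invr1 // -(prim_order_dvd prim_q).
  apply/matrixP => x y; rewrite -colE !mxE ord1 andbT.
  by rewrite mulr_natr.
have b_inj (c c' : nat) : (c < d)%N -> (c' < d)%N ->
    w ^+ i * q ^- c = w ^+ k -> w ^+ i * q ^- c' = w ^+ k -> c = c'.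
  move=> lt_c lt_c' <- /(mulfI (expf_neq0 i w_neq0)) /invr_inj /eqP.
  by rewrite (eq_prim_root_expr prim_q) !modn_small // => /eqP.
have lt_d (c : 'I_(l - j)) : (c < d)%N.
  by have := ltn_ord c; have := le_ld; clear; lia.
have [/existsP[c /eqP bc]|/existsPn b0] :=
  boolP [exists c : 'I_(l - j), w ^+ i * q ^- c == w ^+ k]; last first.
  rewrite big1 => [|c _]; last by rewrite (negPf (b0 c)).
  apply/eqP; rewrite mxrank_eq0; apply/eqP/matrixP => r c; rewrite AE mxE.
  case: eqP => //= bc; case: eqP => // rc; exfalso.
  have lt_c : (c < l - j)%N by have := ltn_ord r; rewrite /= rc ltn_subRL addnC.
  by have := b0 (Ordinal lt_c); rewrite /= bc eqxx.
rewrite (bigD1 c) //= bc eqxx big1 => [|c' ne_c]; last first.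
  case: eqP => // bc'; case/eqP: ne_c; apply: val_inj; exact: b_inj bc' bc.
have lt_cj : (c + j < l)%N by have := ltn_ord c; rewrite ltn_subRL addnC.
have lt_c : (c < l)%N by apply: leq_ltn_trans lt_cj; apply: leq_addr.
have -> : A = delta_mx (Ordinal lt_cj) (Ordinal lt_c).
  apply/matrixP => r c'; rewrite AE mxE; congr (nat_of_bool _)%:R.
  rewrite -!(inj_eq val_inj) /=; apply/andP/andP => [[/eqP bc' /eqP ->]|[/eqP -> /eqP ->]].
    have lt_c'd : (c' < d)%N := leq_trans (ltn_ord c') le_ld.
    have -> : c' = c :> nat by apply: b_inj bc' bc.
    by rewrite !eqxx.
  by rewrite bc !eqxx.
by rewrite mxrank_delta.
Qed.

(** Makes [char_val] equal to zeta^i U_l on M(l,i), where the ranks of h^j, weighted by powers of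
    zeta, add up to geometric sums in b. *)
Lemma cheb_geometric (b z : K) l :
  \sum_(c < l) b ^+ c +
    (z - 1 - b) * \sum_(j < l) cheb b z j * \sum_(c < l - j) b ^+ c = cheb b z l.
Proof.
have geomS N : \sum_(c < N.+1) b ^+ c = 1 + b * \sum_(c < N) b ^+ c.
  rewrite big_ord_recl expr0 mulr_sumr; congr (_ + _).
  by apply: eq_bigr => i _; rewrite -exprS.
(* The recurrence of [cheb] in summed form, which drives the induction on l. *)
have chebS N : cheb b z N.+1 =
    1 + b * cheb b z N + (z - 1 - b) * \sum_(j < N.+1) cheb b z j.
  elim: N => [|N IH]; first by rewrite big_ord1 /= !mulr0 !addr0.
  rewrite big_ord_recr /= mulrDr chebSS.
  have -> : (z - 1 - b) * \sum_(j < N.+1) cheb b z j =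
      cheb b z N.+1 - 1 - b * cheb b z N by rewrite IH; ring.
  by ring.
elim: l => [|l IH]; first by rewrite !big_ord0 mulr0 addr0.
rewrite geomS chebS -{1}IH.
have -> : \sum_(j < l.+1) cheb b z j * \sum_(c < l.+1 - j) b ^+ c =
    \sum_(j < l.+1) cheb b z j +
    b * \sum_(j < l) cheb b z j * \sum_(c < l - j) b ^+ c.
  rewrite [LHS]big_ord_recr [X in _ = X + _]big_ord_recr /=.
  rewrite subSnn big_ord1 expr0 mulr1 addrAC; congr (_ + _).
  rewrite mulr_sumr -big_split; apply: eq_bigr => j _ /=.
  by rewrite subSn ?geomS ?mulrDr ?mulr1 1?mulrCA // ltnW.
by ring.
Qed.

Hypotheses (n_gt1 : (1 < n)%N) (w_q : w ^+ (n %/ d) = q).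
Variables (zeta z : K).
Hypothesis zeta_n : zeta ^+ n = 1.
Local Notation e := (n - n %/ d)%N.
Local Notation b := (zeta ^+ e).
Local Notation U := (cheb b z).
Local Notation green := (green_ring n prim_q).
Local Notation pi := (@green_pi K n d q prim_q).

(* The multiplicity of M(l,i) in [V] is
   r_(l-1)(i) - r_l(i) - r_l(i+m) + r_(l+1)(i+m), with r_j(i) = weight_rank V j i;
   [char_val] is the resulting sum of the values zeta^i * cheb b z l, simplified by
   the recurrence of [cheb]. *)
Definition char_val V : zmodule K :=
  \sum_(k < n) zeta ^+ k * ((weight_rank V 0 k)%:R +
     (z - 1 - b) * \sum_(j < d) U j * (weight_rank V j k)%:R).

Lemma char_val_iso V W : taft_iso V W -> char_val V = char_val W.
Proof.
move=> VW; apply: eq_bigr => k _; rewrite (weight_rank_iso 0 k VW).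
congr (_ * (_ + _ * _)); apply: eq_bigr => j _.
by rewrite (weight_rank_iso j k VW).
Qed.

Lemma char_val_dsum V W : char_val (taft_dsum V W) = char_val V + char_val W.
Proof.
rewrite /char_val -[RHS]big_split; apply: eq_bigr => k _ /=.
rewrite weight_rank_dsum natrD.
under eq_bigr => j _ do rewrite weight_rank_dsum natrD mulrDr.
by rewrite big_split /=; ring.
Qed.

(** After exchanging the sums, each v_c contributes to exactly one k, namely i + e c mod n. *)
Lemma sum_weight_rank_M l (le_ld : (l <= d)%N) (i : 'Z_n) j :
  \sum_(k < n) zeta ^+ k * (weight_rank (M le_ld i) j k)%:R =
  zeta ^+ i * \sum_(c < l - j) b ^+ c.
Proof.
have n_gt0 := ltnW n_gt1.
under eq_bigr => k _ do rewrite weight_rank_M natr_sum mulr_sumr.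
rewrite exchange_big mulr_sumr; apply: eq_bigr => c _ /=.
have wE : w ^+ i * q ^- c = w ^+ (i + e * c).
  have q_neq0 := prim_root_neq0 prim_q.
  rewrite exprD exprM -exprVn; congr (_ * _ ^+ _).
  apply: (mulIf q_neq0); rewrite mulVf // -[in RHS]w_q -exprD subnK ?leq_div //.
  by rewrite (prim_expr_order prim_w).
have lt_k : ((i + e * c) %% n < n)%N by rewrite ltn_pmod.
rewrite (bigD1 (Ordinal lt_k)) //= big1 => [|k ne_k]; last first.
  rewrite wE (eq_prim_root_expr prim_w) [(k %% n)%N]modn_small //.
  by rewrite eq_sym -[_ == _]/(k == Ordinal lt_k) (negPf ne_k) mulr0.
rewrite wE (prim_expr_mod prim_w) eqxx mulr1 addr0.
by rewrite (expr_mod _ zeta_n) exprD exprM.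
Qed.

Lemma char_val_M l (le_ld : (l <= d)%N) (i : 'Z_n) :
  char_val (M le_ld i) = zeta ^+ i * U l.
Proof.
rewrite /char_val -cheb_geometric mulrDr.
under eq_bigr => k _ do rewrite mulrDr mulrCA mulr_sumr.
rewrite big_split /= sum_weight_rank_M subn0; congr (_ + _).
rewrite -mulr_sumr mulrCA; congr (_ * _); rewrite exchange_big /=.
under eq_bigr => j _.
  under eq_bigr => k _ do rewrite mulrCA.
  rewrite -mulr_sumr sum_weight_rank_M mulrCA; over.
rewrite -mulr_sumr; congr (_ * _).
(* The terms with j >= l vanish, h^j being zero on M(l,i). *)
rewrite -(subnKC le_ld) big_split_ord /= [X in _ + X]big1 ?addr0 // => j _.
by rewrite subnDA subnn sub0n big_ord0 mulr0.
Qed.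

Definition green_char (u : green) : K := fglift char_val (repr u).

Lemma fglift_char_rel y : green_rel y -> fglift char_val y = 0.
Proof.
elim=> {y} [|y y' _ IH _ IH'|V W VW|V W].
- exact: fglift0.
- by rewrite fgliftB IH IH' subrr.
- by rewrite fgliftB !liftU !scale1r (char_val_iso VW) subrr.
rewrite fgliftB -[X in _ - fglift _ (_ + X)]opprK fgliftB -sub0r.
by rewrite fgliftB fglift0 !liftU !scale1r char_val_dsum sub0r opprK subrr.
Qed.

Lemma green_char_pi y : green_char (pi y) = fglift char_val y.
Proof.
apply/eqP; rewrite -subr_eq0 -[_ - _](fgliftB (M := zmodule K)); apply/eqP.
exact/fglift_char_rel/green_repr_pi.
Qed.

Lemma green_charB u v : green_char (u - v) = green_char u - green_char v.
Proof.
elim/green_ind: u => y; elim/green_ind: v => y'.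
have -> : pi y - pi y' = pi (y - y').
  by apply/eqP; rewrite subr_eq -green_piD subrK.
by rewrite !green_char_pi fgliftB.
Qed.

Lemma green_char_M (d_gt1 : (1 < d)%N) l k : (l <= d)%N ->
  green_char (green_M dvd_dn prim_q prim_w l k) = zeta ^+ k * U l.
Proof.
move=> le_ld; rewrite (green_ME _ _ _ _ le_ld) green_char_pi liftU scale1r.
rewrite char_val_M val_Zp_nat //.
by rewrite (expr_mod _ zeta_n).
Qed.

End RankInvariants.

(** * The radical of a ring with the relations of the Green ring *)

(* [a ^+ e] stands for the class of M(1,-m), so [e] will be [n - n %/ d]. *)
Section GradedRing.
Variables (R : pzRingType) (n d e : nat) (a x : R) (M : nat -> R).
Hypotheses (d_gt1 : (1 < d)%N) (n_gt0 : (0 < n)%N).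
Hypothesis M0 : M 0 = 0.
Hypothesis M1 : M 1 = 1.
Hypothesis an : a ^+ n = 1.
Hypothesis xa : x * a = a * x.
Hypothesis xM : forall l, (0 < l < d)%N -> x * M l = M l.+1 + a ^+ e * M l.-1.
Hypothesis xMd : x * M d = a ^+ e * M d + M d.
Hypothesis span : forall P : R -> Prop,
  (forall y z, P y -> P z -> P (y - z)) ->
  (forall l k, (0 < l <= d)%N -> P (a ^+ k * M l)) -> forall y, P y.

Lemma MSS l : (l.+2 <= d)%N -> M l.+2 = x * M l.+1 - a ^+ e * M l.
Proof. by move=> lt_ld; rewrite xM //= addrK. Qed.

(** By the recurrence [MSS], M_l is a polynomial in x and a. *)
Lemma comm_M y l : GRing.comm y a -> GRing.comm y x -> (l <= d)%N ->
  GRing.comm y (M l).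
Proof.
move=> ya yx; have [j] := ubnP l; elim: j l => // j IH [|[|l]] lt_lj le_ld.
- by rewrite M0; apply: commr0.
- by rewrite M1; apply: commr1.
rewrite MSS //; apply: commrB; apply: commrM => //.
- by apply: IH => //; apply: ltnW.
- exact: commrX.
- by apply: IH; do 1?[exact: ltnW]; rewrite ltnW // ltnW.
Qed.

Lemma comm_span y : (forall l, (l <= d)%N -> GRing.comm y (M l)) ->
  GRing.comm y a -> forall z, GRing.comm y z.
Proof.
move=> yM ya; apply: span => [u v yu yv|l k /andP[_ le_ld]]; first exact: commrB.
by apply: commrM; [apply: commrX|apply: yM].
Qed.

(** As a and x commute, they commute with every M_l and are central by [span]; then each M_l is
    central too. *)
Lemma graded_mulC (y z : R) : y * z = z * y.
Proof.
have aC : forall u, GRing.comm a u.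
  apply: comm_span => // l; exact: comm_M.
have xC : forall u, GRing.comm x u.
  apply: comm_span => // l; exact: comm_M.
have MC l : (l <= d)%N -> forall u, GRing.comm u (M l).
  by move=> le_ld u; apply: comm_M => //; apply/commr_sym.
apply: (comm_span (y := y)) => [l le_ld|]; first exact: MC.
exact/commr_sym.
Qed.

(** x acts on M_d as 1 + a^e, so M_l acts as U_l(1 + a^e) with parameter a^e, which is a geometric
    sum. *)
Lemma M_mulMd l : (l <= d)%N ->
  M l * M d = (\sum_(j < l) (a ^+ e) ^+ j) * M d.
Proof.
have [j] := ubnP l; elim: j l => // j IH [|[|l]] lt_lj le_ld.
- by rewrite M0 big_ord0.
- by rewrite M1 big_ord1 expr0.
rewrite MSS // mulrBl -mulrA IH //; last exact: ltnW.
rewrite -[_ * M l * _]mulrA IH; [|by rewrite ltnW // ltnW|by rewrite ltnW // ltnW].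
rewrite mulrA [x * _]graded_mulC -mulrA xMd.
have -> : a ^+ e * M d + M d = (a ^+ e + 1) * M d by rewrite mulrDl mul1r.
rewrite !mulrA -mulrBl; congr (_ * _).
have sumS k : \sum_(i < k.+1) (a ^+ e) ^+ i = 1 + a ^+ e * \sum_(i < k) (a ^+ e) ^+ i.
  rewrite big_ord_recl expr0 mulr_sumr; congr (_ + _).
  by apply: eq_bigr => i _; rewrite -exprS.
rewrite mulrDr mulr1 [_ * a ^+ e]graded_mulC [in RHS]sumS.
by rewrite [in X in _ + X - _]sumS addrA addrK addrC.
Qed.

(** By [M_mulMd] the square contains the product of a^m - 1 with the geometric sum in a^e, a unit
    multiple of a^(e d) - 1. *)
Lemma graded_nilp m : (e + m = n)%N -> (m * d = n)%N ->
  ((a ^+ m - 1) * M d) * ((a ^+ m - 1) * M d) = 0.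
Proof.
move=> emn mdn; set b := a ^+ m.
rewrite mulrA -[_ * M d * (b - 1)]mulrA [M d * (b - 1)]graded_mulC !mulrA.
rewrite -mulrA M_mulMd // mulrA -[(b - 1) * _ * _]mulrA.
have -> : b - 1 = - (b * (a ^+ e - 1)).
  by rewrite mulrBr mulr1 -exprD addnC emn an opprB.
rewrite [in X in _ * X * _]mulNr -[b * _ * _]mulrA -subrX1 -exprM.
(* Hence a^(e d) = 1. *)
have -> : (e * d = n * d.-1)%N by nia.
by rewrite exprM an expr1n subrr mulr0 oppr0 mulr0 mul0r.
Qed.

(** * Multiplicativity of characters *)

Section Character.
Variables (K : fieldType) (f : R -> K) (zeta z : K).
Hypothesis fB : forall y t, f (y - t) = f y - f t.
Let U := cheb (zeta ^+ e) z.
Hypothesis fE : forall l k, (0 < l <= d)%N -> f (a ^+ k * M l) = zeta ^+ k * U l.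
Hypothesis zU : (z - 1 - zeta ^+ e) * U d = 0.

Let f0 : f 0 = 0. Proof. by rewrite -(subrr 0) fB subrr. Qed.
Let fN y : f (- y) = - f y. Proof. by rewrite -sub0r fB f0 sub0r. Qed.
Let fD y t : f (y + t) = f y + f t.
Proof. by rewrite -[t in LHS]opprK fB fN opprK. Qed.

Lemma character1 : f 1 = 1.
Proof.
have := fE (l := 1) 0; rewrite M1 !expr0 !mul1r => -> //.
exact: ltnW.
Qed.

Lemma character_a y : f (a * y) = zeta * f y.
Proof.
move: y; apply: span => [y t fy ft|l k l_bd]; first by rewrite mulrBr !fB fy ft mulrBr.
by rewrite mulrA -exprS !fE // exprS mulrA.
Qed.

Lemma character_aX k y : f (a ^+ k * y) = zeta ^+ k * f y.
Proof.
by elim: k => [|k IH]; rewrite ?mul1r // !exprS -!mulrA character_a IH.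
Qed.

(** On M_l with l < d this is the recurrence of [cheb]; on M_d it is [zU], as x acts there by 1 +
    a^e. *)
Lemma character_x y : f (x * y) = z * f y.
Proof.
move: y; apply: span => [y t fy ft|l k l_bd]; first by rewrite mulrBr !fB fy ft mulrBr.
have fM j : (j <= d)%N -> f (M j) = U j.
  case: j => [|j] le_jd; first by rewrite M0 f0.
  by have := fE (l := j.+1) 0; rewrite !expr0 !mul1r => ->.
rewrite mulrA [x * _]graded_mulC -mulrA !character_aX mulrCA; congr (_ * _).
case/andP: l_bd => l_gt0; rewrite leq_eqVlt => /predU1P[->|lt_ld].
  rewrite xMd fD character_aX fM // -[z * _](subrK ((1 + zeta ^+ e) * U d)) -mulrBl opprD.
  by rewrite addrA zU add0r mulrDl mul1r addrC.
rewrite xM ?l_gt0 // fD character_aX !fM //; try by lia.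
by case: l l_gt0 lt_ld => // l _ _; rewrite /U chebSS subrK.
Qed.

(** Compatibility with a and x is enough, because M_l is built from them by the recurrence. *)
Lemma character_mul y t : f (y * t) = f y * f t.
Proof.
move: y; apply: span => [y u fy fu|l k].
  by rewrite mulrBl !fB fy fu mulrBl.
case/andP=> _ le_ld; rewrite -mulrA !character_aX -mulrA; congr (_ * _).
have [j] := ubnP l; elim: j l le_ld => // j IH [|[|l]] le_ld lt_lj.
- by rewrite M0 mul0r f0 mul0r.
- by rewrite M1 mul1r character1 mul1r.
rewrite MSS // mulrBl !fB -!mulrA !character_aX !character_x mulrBl -!mulrA.
by rewrite !IH // ltnW // ltnW.
Qed.

End Character.

Lemma finite_span (y : R) : exists c : 'I_n -> 'I_d -> int,
  y = \sum_(k < n) \sum_(l < d) (a ^+ k * M l.+1) *~ c k l.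
Proof.
move: y; apply: span => [_ _ [c ->] [c' ->]|l k /andP[l_gt0 le_ld]].
  exists (fun k l => c k l - c' k l); rewrite -sumrB; apply: eq_bigr => k _.
  by rewrite -sumrB; apply: eq_bigr => l _; rewrite mulrzBr.
have lt_k : (k %% n < n)%N by rewrite ltn_pmod.
have lt_l : (l.-1 < d)%N by rewrite prednK.
exists (fun k' l' => ((k' == Ordinal lt_k) && (l' == Ordinal lt_l))%:R).
rewrite (bigD1 (Ordinal lt_k)) //= [X in _ + X]big1 ?addr0 => [|k' ne_k]; last first.
  by rewrite big1 // => l' _; rewrite (negPf ne_k) mulr0z.
rewrite (bigD1 (Ordinal lt_l)) //= big1 ?addr0 => [|l' ne_l]; last first.
  by rewrite (negPf ne_l) andbF mulr0z.
by rewrite !eqxx mulr1z prednK // (expr_mod _ an).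
Qed.

(** * Determination of the radical *)

Section Radical.
Variables (K : closedFieldType) (m : nat) (q w : K).
Hypothesis char0 : [pchar K] =i pred0.
Hypotheses (prim_q : d.-primitive_root q) (prim_w : n.-primitive_root w).
Hypotheses (emn : (e + m = n)%N) (mdn : (m * d = n)%N).
Hypothesis characters : forall zeta z : K, zeta ^+ n = 1 ->
  (z - 1 - zeta ^+ e) * cheb (zeta ^+ e) z d = 0 ->
  exists f : R -> K, (forall y t, f (y - t) = f y - f t) /\
    forall l k, (0 < l <= d)%N -> f (a ^+ k * M l) = zeta ^+ k * cheb (zeta ^+ e) z l.
Local Notation theta := ((a ^+ m - 1) * M d).
Local Notation I := (principal_ideal theta).

Lemma finite_span_ord : exists N (g : 'I_N -> R),
  forall y, exists c : 'I_N -> int, y = \sum_i g i *~ c i.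
Proof.
exists #|{: 'I_n * 'I_d}|, 
  (fun i : 'I_#|{: 'I_n * 'I_d}| => a ^+ (enum_val i).1 * M (enum_val i).2.+1) => y.
have [c ->] := finite_span y.
exists (fun i => c (enum_val i).1 (enum_val i).2).
by rewrite pair_bigA (reindex _ (onW_bij _ (@enum_val_bij _))).
Qed.

Lemma jacobson_character0 y (zeta z : K) (c : 'I_n -> 'I_d -> int) :
  jacobson_radical R y -> zeta ^+ n = 1 ->
  (z - 1 - zeta ^+ e) * cheb (zeta ^+ e) z d = 0 ->
  y = \sum_(k < n) \sum_(l < d) (a ^+ k * M l.+1) *~ c k l ->
  \sum_(k < n) \sum_(l < d) (zeta ^+ k * cheb (zeta ^+ e) z l.+1) *~ c k l = 0.
Proof.
move=> Jy zn zU yE; have [f [fB fE]] := characters zn zU.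
have [N [g gspan]] := finite_span_ord.
have fy0 := jacobson_radical_morph0 (intr_eq0_char0 char0) fB (character1 fE)
  (character_mul fB fE zU) gspan Jy.
rewrite -[RHS]fy0 yE (morph_sum fB); apply: eq_bigr => k _.
rewrite (morph_sum fB); apply: eq_bigr => l _.
by rewrite (morph_mulz fB) fE //= ltn_ord.
Qed.

(** Modulo a^m - 1 the exponents of a matter only mod m, and the hypothesis makes the coefficients
    in each residue class sum to zero. *)
Lemma theta_span (c : 'I_n -> int) :
  (forall zeta : K, zeta ^+ m = 1 -> \sum_(k < n) zeta ^+ k *~ c k = 0) ->
  I (\sum_(k < n) (a ^+ k * M d) *~ c k).
Proof.
move=> c0; have m_gt0 : (0 < m)%N by move: n_gt0; rewrite -mdn; case: m.
pose r (k : 'I_n) := Ordinal (ltn_pmod k m_gt0).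
pose D j := \sum_(k < n | r k == j) c k.
have D0 j : D j = 0.
  apply: (intr_eq0_char0 char0).
  have prim_wd : m.-primitive_root (w ^+ (n %/ m)).
    by apply: dvdn_prim_root => //; rewrite -mdn dvdn_mulr.
  apply: (unity_root_inj (c := fun j => (D j)%:~R) prim_wd) => zeta zm.
  rewrite -[RHS](c0 zeta zm) [RHS](partition_big r predT) //=.
  apply: eq_bigr => i _; rewrite /D rmorph_sum mulr_suml.
  apply: eq_bigr => k /eqP <-.
  by rewrite -(expr_mod k zm) mulrC mulrzr.
have [[I0 ID IM] _] := principal_ideal_ideal theta.
have Ik (k : 'I_n) : I (a ^+ k * M d - a ^+ r k * M d).
  have -> : a ^+ k * M d - a ^+ r k * M d =
      a ^+ r k * (\sum_(i < k %/ m) (a ^+ m) ^+ i) * theta.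
    rewrite !mulrA -mulrBl; congr (_ * _); rewrite -mulrA.
    rewrite [_ * (_ - 1)]graded_mulC -subrX1 mulrBr mulr1 -exprM -exprD.
    by rewrite /= mulnC addnC -divn_eq.
  by apply: IM; apply: principal_ideal_gen.
(* Replacing exponents by residues subtracts the sum of the a^j M_d with coefficients [D j], which
   is zero. *)
have -> : \sum_(k < n) (a ^+ k * M d) *~ c k =
    \sum_(k < n) (a ^+ k * M d - a ^+ r k * M d) *~ c k.
  apply/eqP; rewrite -subr_eq0 -sumrB; apply/eqP.
  under eq_bigr => k _ do rewrite -mulrzBl opprB addrC subrK.
  rewrite (partition_big r predT) //= big1 // => j _.
  transitivity ((a ^+ j * M d) *~ D j); last by rewrite D0 mulr0z.
  rewrite /D mulrz_sumr; apply: eq_bigr => k /eqP <- //.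
apply: big_ind => // k _; rewrite -mulrzl; exact: IM.
Qed.

Theorem graded_jacobson : jacobson_radical R = I.
Proof.
have two_neq0 : 2 != 0 :> K by apply/negP => /eqP/(intr_eq0_char0 (c := 2) char0).
apply/seteqP; split=> [y Jy|]; last first.
  apply: principal_ideal_sub; first exact: jacobson_radical_ideal graded_mulC.
  by apply: (jacobson_radical_sqr0 graded_mulC); apply: graded_nilp.
have [c yE] := finite_span y.
have cE := fun zeta z zn zU => @jacobson_character0 y zeta z c Jy zn zU yE.
have lt_l : (d.-1 < d)%N by rewrite prednK // ltnW.
have [c0 cd] := cheb_coef0 d_gt1 prim_q two_neq0 char0 prim_w emn mdn
  (erefl : Ordinal lt_l = d.-1 :> nat) cE.
have -> : y = \sum_(k < n) (a ^+ k * M d) *~ c k (Ordinal lt_l).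
  rewrite yE; apply: eq_bigr => k _; rewrite (bigD1 (Ordinal lt_l)) //= big1.
    by rewrite addr0 prednK // ltnW.
  move=> l ne_l; rewrite c0 ?mulr0z //; have := ltn_ord l.
  by move: ne_l; rewrite -(inj_eq val_inj) /=; lia.
exact: theta_span.
Qed.

End Radical.

End GradedRing.

Theorem corollary5p3 (K : closedFieldType) (char0 : [pchar K] =i pred0)
    (n d : nat) (n_ge2 : (2 <= n)%N) (d_ge2 : (2 <= d)%N) (dvd_dn : (d %| n)%N)
    (q w : K) (prim_q : d.-primitive_root q) (prim_w : n.-primitive_root w)
    (w_q : w ^+ (n %/ d) = q) :
  let m := (n %/ d)%N in
  let cls := @green_class K n d q prim_q in
  let M := @taft_M K n d q w dvd_dn prim_q prim_w in
  jacobson_radical (green_ring n prim_q) =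
  principal_ideal ((cls (M 1%N (ltnW d_ge2) m%:R) - 1) * cls (M d (leqnn d) 0)).
Proof.
move=> m cls M.
have n_neq0 : n%:R != 0 :> K by move/pcharf0P: char0 => ->; rewrite gtn_eqF // ltnW.
pose G := green_M dvd_dn prim_q prim_w.
have GE l k (le_ld : (l <= d)%N) : G l k = G 1 1 ^+ k * G l 0 := green_MX _ _ _ _ _ _ le_ld.
(* [M(1,m)] becomes the m-th power of [M(1,1)], as in [graded_jacobson]. *)
rewrite -[cls (M 1%N _ _)](green_ME _ _ _ _ (ltnW d_ge2)) -(green_M1X _ _ _ n_ge2 d_ge2).
rewrite -[cls (M d _ 0)](green_ME _ _ _ 0 (leqnn d)) -/G.
have mdn : (m * d = n)%N by rewrite divnK.
apply: (@graded_jacobson _ n d (n - m) (G 1 1) (G 2 0) (fun l => G l 0)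
  d_ge2 (ltnW n_ge2) _ _ _ _ _ _ _ K m q w char0 prim_q prim_w) => //.
- exact: green_M0.
- exact: green_M10.
- exact: green_M1X_n.
- exact: green_M2C.
- move=> l /andP[l_gt0 lt_ld]; rewrite [LHS]green_M2M ?l_gt0 //; congr (_ + _).
  exact: GE (leq_trans (leq_pred l) (ltnW lt_ld)).
- by rewrite [LHS]green_M2M_d //; congr (_ + _); apply: GE.
- exact: green_M_span.
- by rewrite subnK // leq_div.
move=> zeta z zn _; exists (green_char w zeta z); split; first exact: green_charB.
by move=> l k /andP[_ le_ld]; rewrite -GE // green_char_M.
Qed.
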